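(* There exists a one-parameter family $(\mathcal{C}_{\alpha})_{\alpha \in ]-1,1[ \setminus \{0\}}$ of properly embedded minimal annuli in $\mathrm{Sol}_3$ (called catenoids) such that for every $\alpha \in ]-1,1[\setminus\{0\}$: 1. for every $\lambda\in\mathbb{R}$, the intersection of $\mathcal{C}_{\alpha}$ with the plane $\{x_3=\lambda\}$ is a non-empty closed embedded convex curve; 2. the annulus $\mathcal{C}_{\alpha}$ is conformally equivalent to $\mathbb{C}\setminus\{0\}$; 3. the annulus $\mathcal{C}_{\alpha}$ has the following 3 symmetries fixing the origin (i.e. it is invariant under the following isometries of $\mathrm{Sol}_3$): the rotation of angle $\pi$ around the $x_3$-axis, $(x_1,x_2,x_3)\mapsto(-x_1,-x_2,x_3)$; the reflection with respect to $\{x_1=0\}$, $(x_1,x_2,x_3)\mapsto(-x_1,x_2,x_3)$; the reflection with respect to $\{x_2=0\}$, $(x_1,x_2,x_3)\mapsto(x_1,-x_2,x_3)$.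
   Context: $\mathrm{Sol}_3$ is the Lie group $\mathbb{R}^3$ with multiplication $(x_1,x_2,x_3)\ast(y_1,y_2,y_3)=(y_1e^{-x_3}+x_1,\;y_2e^{x_3}+x_2,\;x_3+y_3)$, endowed with the left-invariant Riemannian metric $ds^2=e^{2x_3}dx_1^2+e^{-2x_3}dx_2^2+dx_3^2$. Minimal means zero mean curvature for this metric; an annulus is a surface diffeomorphic to $\mathbb{S}^1\times\mathbb{R}$; the conformal structure on a surface in $\mathrm{Sol}_3$ is that of the induced metric. Each plane $\{x_3=\lambda\}$ is flat, with metric $e^{2\lambda}dx_1^2+e^{-2\lambda}dx_2^2$, and convexity of curves in it is the usual one (it is the same in the coordinates $(x_1,x_2)$). *)

(* Defs.v *)
(* Concrete reals of the standard library, with Coquelicot for analysis. *)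
From Stdlib Require Import Reals.
From Coquelicot Require Export Coquelicot.
Open Scope R_scope.

(** * The Riemannian manifold Sol3 *)

(* Points of Sol3 = R^3; tangent vectors are given by their components in the
   coordinate frame (d/dx1, d/dx2, d/dx3). *)
Definition point : Type := (R * R * R)%type.

Inductive axis := A1 | A2 | A3.

Definition coord (i : axis) (p : point) : R :=
  match i with
  | A1 => fst (fst p)
  | A2 => snd (fst p)
  | A3 => snd p
  end.

Definition set_coord (i : axis) (t : R) (p : point) : point :=
  match i with
  | A1 => (t, coord A2 p, coord A3 p)
  | A2 => (coord A1 p, t, coord A3 p)
  | A3 => (coord A1 p, coord A2 p, t)
  end.

Definition partial (i : axis) (f : point -> R) (p : point) : R :=
  Derive (fun t => f (set_coord i t p)) (coord i p).

Definition sum3 (f : axis -> R) : R := f A1 + f A2 + f A3.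

(* ds^2 = e^(2 x3) dx1^2 + e^(-2 x3) dx2^2 + dx3^2 *)
Definition metric (i j : axis) (p : point) : R :=
  match i, j with
  | A1, A1 => exp (2 * coord A3 p)
  | A2, A2 => exp (- (2 * coord A3 p))
  | A3, A3 => 1
  | _, _ => 0
  end.

Definition inner (p : point) (v w : point) : R :=
  sum3 (fun i => sum3 (fun j => metric i j p * coord i v * coord j w)).

(* Christoffel symbols of the first kind of the Levi-Civita connection:
   christoffel k i j p = < nabla_(d_i) d_j , d_k > at p. *)
Definition christoffel (k i j : axis) (p : point) : R :=
  / 2 * (partial i (metric j k) p + partial j (metric i k) p
         - partial k (metric i j) p).

(** * Parametrized surfaces *)

Definition du (f : R -> R -> R) (u v : R) : R := Derive (fun t => f t v) u.
Definition dv (f : R -> R -> R) (u v : R) : R := Derive (fun t => f u t) v.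

(* For an open set U this is C^infinity regularity on U. *)
Definition smooth_on (U : R -> R -> Prop) (f : R -> R -> R) : Prop :=
  forall (n : nat) (u v : R), U u v -> ex_diff_n f n u v.

Definition comp (X : R -> R -> point) (i : axis) (u v : R) : R :=
  coord i (X u v).

Definition lift (d : (R -> R -> R) -> R -> R -> R) (X : R -> R -> point)
  (u v : R) : point :=
  (d (comp X A1) u v, d (comp X A2) u v, d (comp X A3) u v).

(* First fundamental form. *)
Definition fE X u v := inner (X u v) (lift du X u v) (lift du X u v).
Definition fF X u v := inner (X u v) (lift du X u v) (lift dv X u v).
Definition fG X u v := inner (X u v) (lift dv X u v) (lift dv X u v).

Definition immersive (X : R -> R -> point) (u v : R) : Prop :=
  fE X u v * fG X u v - fF X u v ^ 2 > 0.

(* < nabla_(X_a) X_b , N > at X u v, where Xa and Xb are the first derivatives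
   of X in the directions a and b, and Xab is the second one. *)
Definition second_form (p Xa Xb Xab N : point) : R :=
  inner p Xab N +
  sum3 (fun k => sum3 (fun i => sum3 (fun j =>
    christoffel k i j p * coord i Xa * coord j Xb * coord k N))).

Definition unit_normal (X : R -> R -> point) (u v : R) (N : point) : Prop :=
  inner (X u v) N N = 1 /\
  inner (X u v) N (lift du X u v) = 0 /\
  inner (X u v) N (lift dv X u v) = 0.

Definition mean_curvature (X : R -> R -> point) (u v : R) (N : point) : R :=
  let Xu := lift du X u v in
  let Xv := lift dv X u v in
  let l := second_form (X u v) Xu Xu (lift (fun f => du (du f)) X u v) N in
  let m := second_form (X u v) Xu Xv (lift (fun f => du (dv f)) X u v) N in
  let n := second_form (X u v) Xv Xv (lift (fun f => dv (dv f)) X u v) N in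
  (fE X u v * n - 2 * fF X u v * m + fG X u v * l)
  / (2 * (fE X u v * fG X u v - fF X u v ^ 2)).

(** * Properly embedded minimal annuli *)

(* Maps from S^1 x R are maps X theta s from R^2 that are 2pi-periodic in
   theta.  A proper injective immersion is a proper embedding; since closed
   bounded sets are the compact sets of R^3 and S^1 is compact, properness
   says that s stays bounded when X theta s does. *)
Definition proper_annulus_embedding (X : R -> R -> point) : Prop :=
  (forall i, smooth_on (fun _ _ => True) (comp X i)) /\
  (forall theta s, X (theta + 2 * PI) s = X theta s) /\
  (forall theta s, immersive X theta s) /\
  (forall theta s theta' s', X theta s = X theta' s' ->
     s = s' /\ exists k : Z, theta' = theta + 2 * PI * IZR k) /\
  (forall M : R, exists K : R, forall theta s,
     (forall i, Rabs (coord i (X theta s)) <= M) -> Rabs s <= K).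

Definition minimal_immersion (X : R -> R -> point) : Prop :=
  forall u v N, unit_normal X u v N -> mean_curvature X u v N = 0.

Definition properly_embedded_minimal_annulus
  (S : point -> Prop) (X : R -> R -> point) : Prop :=
  proper_annulus_embedding X /\ minimal_immersion X /\
  (forall p, S p <-> exists theta s, X theta s = p).

(** * Conformal type *)

(* S is an embedded surface.  A smooth conformal bijection Y from C \ {0} onto
   S is an immersion because its conformal factor fE is positive, so it is a
   diffeomorphism onto S. *)
Definition conformal_to_punctured_plane (S : point -> Prop) : Prop :=
  exists Y : C -> point,
    let Yxy := fun x y : R => Y (x, y) in
    (forall i, smooth_on (fun x y => (x, y) <> RtoC 0) (comp Yxy i)) /\
    (forall z w : C, z <> RtoC 0 -> w <> RtoC 0 -> Y z = Y w -> z = w) /\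
    (forall p, S p <-> exists z : C, z <> RtoC 0 /\ Y z = p) /\
    (forall x y : R, (x, y) <> RtoC 0 ->
       fE Yxy x y > 0 /\ fE Yxy x y = fG Yxy x y /\ fF Yxy x y = 0).

(** * Plane convex curves *)

(* D is the image of a smooth embedding of the circle R / 2pi Z into R^2, and
   it lies on one side of each of its tangent lines. *)
Definition closed_embedded_convex_curve (D : R -> R -> Prop) : Prop :=
  exists c1 c2 : R -> R,
    (forall n t, ex_derive_n c1 n t /\ ex_derive_n c2 n t) /\
    (forall t, c1 (t + 2 * PI) = c1 t /\ c2 (t + 2 * PI) = c2 t) /\
    (forall t, Derive c1 t <> 0 \/ Derive c2 t <> 0) /\
    (forall t t', c1 t = c1 t' -> c2 t = c2 t' ->
       exists k : Z, t' = t + 2 * PI * IZR k) /\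
    (forall x y, D x y <-> exists t, c1 t = x /\ c2 t = y) /\
    (let side t s :=
       Derive c1 t * (c2 s - c2 t) - Derive c2 t * (c1 s - c1 t) in
     forall t, (forall s, 0 <= side t s) \/ (forall s, side t s <= 0)).

(** * Symmetries and families *)

Definition rotation_x3 (p : point) : point :=
  (- coord A1 p, - coord A2 p, coord A3 p).
Definition reflection_x1 (p : point) : point :=
  (- coord A1 p, coord A2 p, coord A3 p).
Definition reflection_x2 (p : point) : point :=
  (coord A1 p, - coord A2 p, coord A3 p).

Definition invariant_under (f : point -> point) (S : point -> Prop) : Prop :=
  forall q, S q <-> exists p, S p /\ f p = q.

Definition parameter (a : R) : Prop := -1 < a < 1 /\ a <> 0.

(* The sets S a, parametrized by X a, form a genuine one-parameter family: X
   depends continuously on the parameter, and the parameter is effective on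
   each of the intervals ]-1,0[ and ]0,1[.  Nothing is said about S a and
   S (- a), which may coincide. *)
Definition one_parameter_family
  (S : R -> point -> Prop) (X : R -> R -> R -> point) : Prop :=
  (forall i a theta s, parameter a ->
     continuous (fun q : R * R * R =>
                   coord i (X (fst (fst q)) (snd (fst q)) (snd q)))
                (a, theta, s)) /\
  (forall a b, parameter a -> parameter b -> 0 < a * b ->
     (forall p, S a p <-> S b p) -> a = b).

(* Main.v *)
From Stdlib Require Import Reals Lra Lia ZArith FunctionalExtensionality.
Require Import Defs.
Open Scope R_scope.

(** The catenoids come from a separation of variables in the Weierstrass
    representation of minimal surfaces of Sol3.  In a conformal coordinate
    [u + i v], the Gauss map is taken, up to sign, of the form
    [i exp (- u - lag + i t)] where [t] and [lag] depend on [v] alone.  The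
    equation of harmonicity then reduces to [dt/dv = speed a t], and integration
    of the representation formula gives [x3 = a u + shift a t] together with
    closed formulas for [x1], [x2].

    The surface becomes elementary when [t] and the height [s = x3] are used as
    coordinates instead of [u], [v]: this is [catenoid].  In the orthonormal frame
    [exp (- s) d1, exp s d2, d3] its tangent plane is spanned by
    [radius * (cos t, sin t, 0)] and
    [- tangential * (cos t, sin t, 0) + sinh phase * (- sin t, cos t, 0) + (0, 0, 1)]
    ([is_derive_catenoid_t], [is_derive_catenoid_s]).  All the claims can be
    read off these two vectors.

    - Minimality ([catenoid_minimal]) is the algebraic identity [radius_balance]
      once the Christoffel symbols are expanded.
    - At a fixed height [t] is the angle of the tangent, [radius] has a constant
      sign, and the formulas are 2 PI periodic in [t].  A closed curve whose
      tangent turns monotonically exactly once lies strictly on one side of each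
      tangent line ([gap_pos]), so it is embedded and convex.  As [s] is itself a
      coordinate of space, the whole surface is then properly embedded.
    - The relations [speed * F + twist * G = 0] and
      [speed ^ 2 * E = (a ^ 2 + twist ^ 2) * G] between the coefficients of the
      metric say that [u + i v] is conformal.  The period of [v] is that of the
      elliptic integral of [/ speed], hence the exponential of a multiple of
      [u + i v] identifies the surface with the punctured plane
      ([conformal_map]).
    - The symmetries are [t |-> t + PI] and [t |-> - t].
    - At height [s] the width in the direction [x2] is a combination of
      [exp (s + s / a)] and [exp (s - s / a)], from which [Rabs a] can be
      recovered ([catenoid_family]).

    Smoothness is obtained from classes of functions that are stable under
    partial derivation ([derivation_closed_smooth]): polynomials in finitely
    many explicit functions on the annulus, and their compositions with the
    conformal coordinates on the punctured plane. *)

(** * Classes of smooth functions *)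

Lemma differentiable_pt_lim_mult (f g : R -> R -> R) (x y fx fy gx gy : R) :
  differentiable_pt_lim f x y fx fy -> differentiable_pt_lim g x y gx gy ->
  differentiable_pt_lim (fun u v => f u v * g u v) x y
    (fx * g x y + f x y * gx) (fy * g x y + f x y * gy).
Proof.
  intros Hf Hg.
  assert (Hm : differentiable_pt_lim Rmult (f x y) (g x y) (g x y) (f x y)).
  { intros eps. exists eps. intros u v Hu Hv.
    replace (u * v - f x y * g x y - (g x y * (u - f x y) + f x y * (v - g x y)))
      with ((u - f x y) * (v - g x y)) by ring.
    rewrite Rabs_mult. apply Rmult_le_compat; try apply Rabs_pos.
    - now left.
    - apply Rmax_r. }
  replace (fx * g x y + f x y * gx) with (g x y * fx + f x y * gx) by ring.
  replace (fy * g x y + f x y * gy) with (g x y * fy + f x y * gy) by ring.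
  exact (differentiable_pt_lim_comp Rmult f g x y _ _ _ _ _ _ Hm Hf Hg).
Qed.

Lemma differentiable_pt_lim_plus (f g : R -> R -> R) (x y fx fy gx gy : R) :
  differentiable_pt_lim f x y fx fy -> differentiable_pt_lim g x y gx gy ->
  differentiable_pt_lim (fun u v => f u v + g u v) x y (fx + gx) (fy + gy).
Proof.
  intros Hf Hg.
  assert (Hm : differentiable_pt_lim Rplus (f x y) (g x y) 1 1).
  { intros eps. exists eps. intros u v Hu Hv.
    replace (u + v - (f x y + g x y) - (1 * (u - f x y) + 1 * (v - g x y)))
      with 0 by ring.
    rewrite Rabs_R0. apply Rmult_le_pos; [left; apply eps|].
    eapply Rle_trans; [apply Rabs_pos | apply Rmax_l]. }
  replace (fx + gx) with (1 * fx + 1 * gx) by ring.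
  replace (fy + gy) with (1 * fy + 1 * gy) by ring.
  exact (differentiable_pt_lim_comp Rplus f g x y _ _ _ _ _ _ Hm Hf Hg).
Qed.

Lemma differentiable_pt_lim_comp1 (g : R -> R) (f : R -> R -> R) (x y l fx fy : R) :
  is_derive g (f x y) l -> differentiable_pt_lim f x y fx fy ->
  differentiable_pt_lim (fun u v => g (f u v)) x y (l * fx) (l * fy).
Proof.
  intros Hg Hf. apply is_derive_Reals in Hg.
  apply (differentiable_pt_lim_proj1_0 _ _ 0) in Hg.
  replace (l * fx) with (l * fx + 0 * 0) by ring.
  replace (l * fy) with (l * fy + 0 * 0) by ring.
  apply (differentiable_pt_lim_comp (fun u _ => g u) f (fun _ _ => 0) x y
           l 0 fx fy 0 0 Hg Hf).
  intros eps. exists eps. intros u v _ _.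
  replace (0 - 0 - _) with 0 by ring. rewrite Rabs_R0.
  apply Rmult_le_pos; [left; apply eps|].
  eapply Rle_trans; [apply Rabs_pos | apply Rmax_l].
Qed.

Lemma differentiable_pt_lim_linear (a b c x y : R) :
  differentiable_pt_lim (fun u v => a * u + b * v + c) x y a b.
Proof.
  intros eps. exists eps. intros u v _ _.
  replace (_ - _ - _) with 0 by ring. rewrite Rabs_R0.
  apply Rmult_le_pos; [left; apply eps|].
  eapply Rle_trans; [apply Rabs_pos | apply Rmax_l].
Qed.

Lemma differentiable_pt_lim_fst (x y : R) :
  differentiable_pt_lim (fun u _ => u) x y 1 0.
Proof.
  apply (differentiable_pt_lim_ext (fun u v => 1 * u + 0 * v + 0)).
  - apply locally_2d_forall; intros; ring.
  - apply differentiable_pt_lim_linear.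
Qed.

Lemma differentiable_pt_lim_snd (x y : R) :
  differentiable_pt_lim (fun _ v => v) x y 0 1.
Proof.
  apply (differentiable_pt_lim_ext (fun u v => 0 * u + 1 * v + 0)).
  - apply locally_2d_forall; intros; ring.
  - apply differentiable_pt_lim_linear.
Qed.

Lemma differentiable_pt_lim_is_derive (f : R -> R -> R) (x y fx fy : R) :
  differentiable_pt_lim f x y fx fy ->
  is_derive (fun t => f t y) x fx /\ is_derive (fun t => f x t) y fy.
Proof.
  intros H. split; apply is_derive_Reals.
  - replace fx with (fx * 1 + fy * 0) by ring.
    apply (derivable_pt_lim_comp_2d f (fun t => t) (fun _ => y)); trivial.
    + apply derivable_pt_lim_id.
    + apply derivable_pt_lim_const.
  - replace fy with (fx * 0 + fy * 1) by ring.
    apply (derivable_pt_lim_comp_2d f (fun _ => x) (fun t => t)); trivial.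
    + apply derivable_pt_lim_const.
    + apply derivable_pt_lim_id.
Qed.

(** The two derivatives are required on [U] only, because on the complement
    [Derive] takes meaningless values. *)
Definition derivation_closed (U : R -> R -> Prop) (K : (R -> R -> R) -> Prop) :=
  forall f, K f -> exists fx fy, K fx /\ K fy /\
    forall x y, U x y -> differentiable_pt_lim f x y (fx x y) (fy x y).

(** Smoothness without computing any higher derivative: by induction on the
    order, all derivatives of a member agree on [U] with members. *)
Lemma derivation_closed_smooth (U : R -> R -> Prop) (K : (R -> R -> R) -> Prop) :
  (forall x y, U x y -> locally_2d U x y) -> derivation_closed U K ->
  forall f, K f -> smooth_on U f.
Proof.
  intros HU HK f Kf n. revert f Kf. induction n as [|n IH]; intros f Kf x y Uxy;
    destruct (HK f Kf) as (fx & fy & Kx & Ky & D); simpl.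
  - split; trivial. apply differentiable_continuity_pt.
    exists (fx x y), (fy x y). now apply D.
  - split; [|split; [|split; [|split]]].
    + apply differentiable_continuity_pt. exists (fx x y), (fy x y). now apply D.
    + eexists. now apply (differentiable_pt_lim_is_derive _ _ _ _ _ (D x y Uxy)).
    + eexists. now apply (differentiable_pt_lim_is_derive _ _ _ _ _ (D x y Uxy)).
    + apply (ex_diff_n_ext_loc fx).
      * apply (locally_2d_impl U); [apply locally_2d_forall | now apply HU].
        intros u v Huv. symmetry. apply is_derive_unique.
        now apply (differentiable_pt_lim_is_derive _ _ _ _ _ (D u v Huv)).
      * now apply IH.
    + apply (ex_diff_n_ext_loc fy).
      * apply (locally_2d_impl U); [apply locally_2d_forall | now apply HU].
        intros u v Huv. symmetry. apply is_derive_unique.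
        now apply (differentiable_pt_lim_is_derive _ _ _ _ _ (D u v Huv)).
      * now apply IH.
Qed.

Lemma derivation_closed_slice (K : (R -> R -> R) -> Prop) :
  derivation_closed (fun _ _ => True) K ->
  forall f, K f -> forall n t s, ex_derive_n (fun t => f t s) n t.
Proof.
  intros HK.
  assert (H : forall n f, K f ->
            exists g, K g /\ forall t s, Derive_n (fun t => f t s) n t = g t s).
  { induction n as [|n IH]; intros f Kf.
    - now exists f.
    - destruct (IH f Kf) as (g & Kg & E).
      destruct (HK g Kg) as (gx & gy & Kx & _ & D).
      exists gx. split; trivial. intros t s. simpl.
      rewrite (Derive_ext _ (fun t => g t s)) by (intros; apply E).
      apply is_derive_unique.
      now apply (differentiable_pt_lim_is_derive _ _ _ _ _ (D t s I)). }
  intros f Kf [|n] t s; simpl; trivial.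
  destruct (H n f Kf) as (g & Kg & E).
  destruct (HK g Kg) as (gx & gy & _ & _ & D).
  apply (ex_derive_ext (fun t => g t s)); [intros; symmetry; apply E|].
  eexists. now apply (differentiable_pt_lim_is_derive _ _ _ _ _ (D t s I)).
Qed.

Inductive poly (G : (R -> R -> R) -> Prop) : (R -> R -> R) -> Prop :=
| poly_gen f : G f -> poly G f
| poly_const c : poly G (fun _ _ => c)
| poly_plus f g : poly G f -> poly G g -> poly G (fun x y => f x y + g x y)
| poly_mult f g : poly G f -> poly G g -> poly G (fun x y => f x y * g x y).

Lemma poly_ext G f g : (forall x y, f x y = g x y) -> poly G f -> poly G g.
Proof.
  intros E Hf. replace g with f; trivial.
  extensionality x. extensionality y. apply E.
Qed.

Lemma poly_opp G f : poly G f -> poly G (fun x y => - f x y).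
Proof.
  intros Hf. apply (poly_ext _ (fun x y => (-1) * f x y)); [intros; ring|].
  apply (poly_mult G (fun _ _ => -1)); trivial. apply poly_const.
Qed.

Lemma poly_minus G f g :
  poly G f -> poly G g -> poly G (fun x y => f x y - g x y).
Proof.
  intros Hf Hg. unfold Rminus.
  apply (poly_plus G f (fun x y => - g x y)); trivial. now apply poly_opp.
Qed.

(** By the rules of Leibniz, only the generators have to be differentiated. *)
Lemma poly_derivation_closed (U : R -> R -> Prop) (G : (R -> R -> R) -> Prop) :
  (forall f, G f -> exists fx fy, poly G fx /\ poly G fy /\
     forall x y, U x y -> differentiable_pt_lim f x y (fx x y) (fy x y)) ->
  derivation_closed U (poly G).
Proof.
  intros HG f Pf. induction Pf as [f Gf | c | f g Pf IHf Pg IHg | f g Pf IHf Pg IHg].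
  - now apply HG.
  - exists (fun _ _ => 0), (fun _ _ => 0).
    split; [apply poly_const | split; [apply poly_const|]].
    intros x y _. apply (differentiable_pt_lim_ext (fun u v => 0 * u + 0 * v + c)).
    + apply locally_2d_forall; intros; ring.
    + apply differentiable_pt_lim_linear.
  - destruct IHf as (fx & fy & Hfx & Hfy & Df), IHg as (gx & gy & Hgx & Hgy & Dg).
    exists (fun x y => fx x y + gx x y), (fun x y => fy x y + gy x y).
    split; [now apply poly_plus | split; [now apply poly_plus|]].
    intros x y Hxy. apply differentiable_pt_lim_plus; auto.
  - destruct IHf as (fx & fy & Hfx & Hfy & Df), IHg as (gx & gy & Hgx & Hgy & Dg).
    exists (fun x y => fx x y * g x y + f x y * gx x y),
           (fun x y => fy x y * g x y + f x y * gy x y).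
    split; [|split].
    + apply (poly_plus G (fun x y => fx x y * g x y) (fun x y => f x y * gx x y));
        now apply poly_mult.
    + apply (poly_plus G (fun x y => fy x y * g x y) (fun x y => f x y * gy x y));
        now apply poly_mult.
    + intros x y Hxy. apply differentiable_pt_lim_mult; auto.
Qed.

(** * The functions of the angle *)

Ltac rewrite_derive H :=
  match type of H with
  | is_derive ?f ?t ?l =>
      replace (Derive (fun x : R => f x) t) with l
        by (symmetry; exact (is_derive_unique f t l H))
  end.

(** With [dt/dv = speed a t] in conformal coordinates, [twist], [- a sin 2t] are
    the derivatives of [shift], [lag] with respect to [v]; thus
    [twist = (1 - speed) / sin 2t], in a form that makes sense where the sine
    vanishes.  The function [phase] is [- u - lag], with [u] expressed through
    the height [s = a u + shift]. *)
Definition speed (a t : R) : R := sqrt (1 - (a * sin (2 * t)) ^ 2).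
Definition twist (a t : R) : R := a ^ 2 * sin (2 * t) / (1 + speed a t).
Definition shift (a t : R) : R :=
  (ln (speed a t + 1 - a ^ 2 - a ^ 2 * cos (2 * t))
   - ln (speed a t + 1 - a ^ 2 + a ^ 2 * cos (2 * t))) / 4.
Definition lag (a t : R) : R := ln (speed a t + a * cos (2 * t)) / 2.
Definition phase (a t s : R) : R := (shift a t - s) / a - lag a t.

Lemma sin2_cos2' t : sin t ^ 2 + cos t ^ 2 = 1.
Proof. generalize (sin2_cos2 t). unfold Rsqr. lra. Qed.

Lemma square_lt_1 a : -1 < a < 1 -> a ^ 2 < 1.
Proof. nra. Qed.

Lemma speed_radicand_pos a t : -1 < a < 1 -> 0 < 1 - (a * sin (2 * t)) ^ 2.
Proof.
  intros Ha. apply square_lt_1 in Ha. generalize (sin2_cos2' (2 * t)). intros.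
  replace ((a * sin (2 * t)) ^ 2) with (a ^ 2 * sin (2 * t) ^ 2) by ring. nra.
Qed.

Lemma speed_sqr a t : -1 < a < 1 -> speed a t ^ 2 = 1 - (a * sin (2 * t)) ^ 2.
Proof.
  intros Ha. unfold speed. rewrite pow2_sqrt; trivial.
  left. now apply speed_radicand_pos.
Qed.

Lemma speed_pos a t : -1 < a < 1 -> 0 < speed a t.
Proof. intros Ha. now apply sqrt_lt_R0, speed_radicand_pos. Qed.

Lemma speed_le_1 a t : -1 < a < 1 -> speed a t <= 1.
Proof.
  intros Ha. generalize (speed_sqr a t Ha) (speed_pos a t Ha). nra.
Qed.

Lemma speed_gt a t : -1 < a < 1 -> Rabs (a * cos (2 * t)) < speed a t.
Proof.
  intros Ha. rewrite <- (Rabs_pos_eq (speed a t)) by (left; now apply speed_pos).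
  apply Rsqr_lt_abs_0. rewrite !Rsqr_pow2.
  rewrite speed_sqr by trivial. apply square_lt_1 in Ha.
  generalize (sin2_cos2' (2 * t)). nra.
Qed.

Lemma lag_argument_pos a t : -1 < a < 1 -> 0 < speed a t + a * cos (2 * t).
Proof.
  intros Ha. generalize (speed_gt a t Ha). intros H.
  apply Rabs_def2 in H. lra.
Qed.

Lemma shift_arguments_pos a t : -1 < a < 1 ->
  0 < speed a t + 1 - a ^ 2 - a ^ 2 * cos (2 * t) /\
  0 < speed a t + 1 - a ^ 2 + a ^ 2 * cos (2 * t).
Proof.
  intros Ha. assert (H := speed_gt a t Ha). assert (H1 := square_lt_1 a Ha).
  assert (H2 : Rabs (a ^ 2 * cos (2 * t)) < speed a t).
  { eapply Rle_lt_trans; [|apply H].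
    replace (a ^ 2 * cos (2 * t)) with (a * (a * cos (2 * t))) by ring.
    rewrite Rabs_mult. rewrite <- (Rmult_1_l (Rabs (a * cos _))) at 2.
    apply Rmult_le_compat_r; [apply Rabs_pos|].
    apply Rabs_le. lra. }
  apply Rabs_def2 in H2. lra.
Qed.

Lemma is_derive_speed (a t : R) : -1 < a < 1 ->
  is_derive (speed a) t (- (2 * a ^ 2 * sin (2 * t) * cos (2 * t)) / speed a t).
Proof.
  intros Ha. unfold speed. auto_derive.
  - generalize (speed_radicand_pos a t Ha). simpl. lra.
  - change (a * sin (2 * t) * (a * sin (2 * t) * 1)) with ((a * sin (2 * t)) ^ 2).
    fold (Rminus 1 ((a * sin (2 * t)) ^ 2)). fold (speed a t).
    field. apply Rgt_not_eq. now apply speed_pos.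
Qed.

Lemma is_derive_twist (a t : R) : -1 < a < 1 ->
  is_derive (twist a) t
    (2 * a ^ 2 * cos (2 * t) / (speed a t * (1 + speed a t))).
Proof.
  intros Ha. assert (Hw := speed_pos a t Ha). assert (Dw := is_derive_speed a t Ha).
  assert (E := speed_sqr a t Ha).
  unfold twist. auto_derive.
  - split; [eexists; apply Dw | split; trivial; lra].
  - rewrite_derive Dw. set (w := speed a t) in *. set (S := sin (2 * t)) in *.
    set (c := cos (2 * t)).
    transitivity (2 * a ^ 2 * c * (w + (w ^ 2 + (a * S) ^ 2)) / (w * (1 + w) ^ 2)).
    + field. lra.
    + rewrite E. field. lra.
Qed.

(** The primitive of [twist / speed] is elementary because, as a function of
    [cos 2t], it is the integral of a rational function of a variable and the
    square root of a quadratic polynomial in it. *)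
Lemma is_derive_shift (a t : R) : -1 < a < 1 ->
  is_derive (shift a) t (twist a t / speed a t).
Proof.
  intros Ha. assert (Hw := speed_pos a t Ha). assert (Dw := is_derive_speed a t Ha).
  assert (E := speed_sqr a t Ha). assert (Hk := square_lt_1 a Ha).
  destruct (shift_arguments_pos a t Ha) as [P1 P2].
  assert (SC := sin2_cos2' (2 * t)).
  unfold shift. auto_derive.
  - split; [eexists; apply Dw | split; [lra | split; [eexists; apply Dw | lra]]].
  - rewrite_derive Dw. unfold twist.
    set (w := speed a t) in *. set (S := sin (2 * t)) in *.
    set (c := cos (2 * t)) in *.
    (* the arguments of the two logarithms have product (1 - a^2) (1 + w)^2 *)
    assert (E1 : (a * c) ^ 2 = w ^ 2 - (1 - a ^ 2)).
    { rewrite E. replace ((a * c) ^ 2) with (a ^ 2 * (S ^ 2 + c ^ 2 - S ^ 2)) by ring.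
      rewrite SC. ring. }
    assert (E2 : (w + 1 - a ^ 2 - a ^ 2 * c) * (w + 1 - a ^ 2 + a ^ 2 * c)
                 = (1 - a ^ 2) * (1 + w) ^ 2).
    { replace (_ * _) with ((w + 1 - a ^ 2) ^ 2 - a ^ 2 * (a * c) ^ 2) by ring.
      rewrite E1. ring. }
    transitivity (a ^ 2 * S * ((w + 1 - a ^ 2) * w - (a * c) ^ 2)
      / (w * ((w + 1 - a ^ 2 - a ^ 2 * c) * (w + 1 - a ^ 2 + a ^ 2 * c)))).
    + field. lra.
    + rewrite E1, E2. field. lra.
Qed.

Lemma is_derive_lag (a t : R) : -1 < a < 1 ->
  is_derive (lag a) t (- (a * sin (2 * t)) / speed a t).
Proof.
  intros Ha. assert (Hw := speed_pos a t Ha). assert (Dw := is_derive_speed a t Ha).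
  assert (P := lag_argument_pos a t Ha).
  unfold lag. auto_derive.
  - split; [eexists; apply Dw | lra].
  - rewrite_derive Dw.
    field. lra.
Qed.

(** * The surface and its tangent vectors *)

Lemma cosh_pos x : 0 < cosh x.
Proof. unfold cosh. generalize (exp_pos x) (exp_pos (- x)). lra. Qed.

Lemma cosh_sqr x : cosh x ^ 2 = 1 + sinh x ^ 2.
Proof.
  assert (E : exp x * exp (- x) = 1) by (rewrite <- exp_plus, Rplus_opp_r; apply exp_0).
  unfold cosh, sinh. transitivity (exp x * exp (- x) + ((exp x - exp (- x)) / 2) ^ 2).
  - field.
  - rewrite E. ring.
Qed.

(** Signed radius of curvature of the section at height [s], for the flat metric
    of the horizontal plane. *)
Definition radius (a t s : R) : R :=
  2 * a * cosh (phase a t s) / (speed a t * (1 + speed a t)).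

(** Horizontal coordinates relative to the orthonormal frame
    [exp (- s) d1, exp s d2]: the primitives in [u] of the Weierstrass formulas,
    which are elementary because [exp (- s)] and the hyperbolic functions of
    [phase] are exponential in [u] at fixed [t].  The denominator comes from the
    product of the exponents [a - 1] and [a + 1]. *)
Definition frame1 (a t s : R) : R :=
  (a * (sin t - twist a t * cos t) * cosh (phase a t s)
   + (twist a t * cos t - a ^ 2 * sin t) * sinh (phase a t s)) / (1 - a ^ 2).
Definition frame2 (a t s : R) : R :=
  (a * (twist a t * sin t - cos t) * cosh (phase a t s)
   + (twist a t * sin t - a ^ 2 * cos t) * sinh (phase a t s)) / (1 - a ^ 2).
Definition catenoid (a t s : R) : point :=
  (exp (- s) * frame1 a t s, exp s * frame2 a t s, s).

Section TangentVectors.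

Variable a : R.
Hypothesis Ha : parameter a.

Let Ha1 : -1 < a < 1 := proj1 Ha.
Let Ha0 : a <> 0 := proj2 Ha.

Let one_minus_sqr_neq : 1 - a ^ 2 <> 0.
Proof. generalize (square_lt_1 a Ha1). lra. Qed.

Lemma is_derive_phase_t (t s : R) :
  is_derive (fun t => phase a t s) t
    (a * sin (2 * t) * (2 + speed a t) / (speed a t * (1 + speed a t))).
Proof.
  assert (Hw := speed_pos a t Ha1). assert (D1 := is_derive_shift a t Ha1).
  assert (D2 := is_derive_lag a t Ha1).
  unfold phase. auto_derive.
  - split; [eexists; apply D1 | split; [eexists; apply D2 | trivial]].
  - rewrite_derive D1. rewrite_derive D2. unfold twist. field. lra.
Qed.

Lemma is_derive_phase_s (t s : R) : is_derive (fun s => phase a t s) s (- / a).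
Proof. unfold phase. auto_derive; trivial. now field. Qed.

Lemma twist_sin t : twist a t * sin (2 * t) = 1 - speed a t.
Proof.
  assert (Hw := speed_pos a t Ha1). unfold twist.
  transitivity ((1 - speed a t ^ 2) / (1 + speed a t)).
  - rewrite speed_sqr by trivial. field. lra.
  - field. lra.
Qed.

Lemma twist_sqr t : a ^ 2 + twist a t ^ 2 = 2 * a ^ 2 / (1 + speed a t).
Proof.
  assert (Hw := speed_pos a t Ha1). unfold twist.
  transitivity (a ^ 2 * ((1 + speed a t) ^ 2 + (a * sin (2 * t)) ^ 2)
                / (1 + speed a t) ^ 2).
  - field. lra.
  - replace ((a * sin (2 * t)) ^ 2) with (1 - speed a t ^ 2)
      by (rewrite speed_sqr by trivial; ring).
    field. lra.
Qed.

Ltac derive_frame :=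
  auto_derive;
  [ repeat split; trivial; eexists; eassumption | ];
  repeat match goal with H : is_derive _ _ _ |- _ => rewrite_derive H; clear H end.

(** The sections have tangent direction [(cos t, sin t)].  After division by
    [speed * (1 + speed)] everything reduces to the addition formulas for
    [2 t - t] and to the definition of [speed]. *)
Lemma is_derive_frame_t (t s : R) :
  is_derive (fun t => frame1 a t s) t (radius a t s * cos t) /\
  is_derive (fun t => frame2 a t s) t (radius a t s * sin t).
Proof.
  assert (Hw := speed_pos a t Ha1).
  assert (Dq := is_derive_twist a t Ha1).
  assert (Dr := is_derive_phase_t t s).
  assert (E : (a * sin (2 * t)) ^ 2 + speed a t ^ 2 - 1 = 0)
    by (rewrite speed_sqr by trivial; ring).
  assert (T1 : cos (2 * t) * cos t + sin (2 * t) * sin t - cos t = 0).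
  { rewrite <- cos_minus. replace (2 * t - t) with t by ring. ring. }
  assert (T2 : sin (2 * t) * cos t - cos (2 * t) * sin t - sin t = 0).
  { rewrite <- sin_minus. replace (2 * t - t) with t by ring. ring. }
  unfold frame1, frame2, radius. split; derive_frame; unfold twist;
    set (w := speed a t) in *; set (S := sin (2 * t)) in *;
    set (c := cos (2 * t)) in *; set (ch := cosh (phase a t s));
    set (sh := sinh (phase a t s)).
  - apply Rminus_diag_uniq.
    transitivity (a / (w * (1 + w)) *
      (ch * (- 2 * a ^ 2 * (c * cos t + S * sin t - cos t)
             + cos t * (2 + w) / (1 + w) * ((a * S) ^ 2 + w ^ 2 - 1))
       + sh * a * (2 * (c * cos t + S * sin t - cos t)
             - cos t * (2 + w) / (1 + w) * ((a * S) ^ 2 + w ^ 2 - 1)))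
      / (1 - a ^ 2)).
    + field. lra.
    + rewrite T1, E. field. lra.
  - apply Rminus_diag_uniq.
    transitivity (a / (w * (1 + w)) *
      (ch * (- 2 * a ^ 2 * (S * cos t - c * sin t - sin t)
             + sin t * (2 + w) / (1 + w) * ((a * S) ^ 2 + w ^ 2 - 1))
       + sh * a * (- 2 * (S * cos t - c * sin t - sin t)
             + sin t * (2 + w) / (1 + w) * ((a * S) ^ 2 + w ^ 2 - 1)))
      / (1 - a ^ 2)).
    + field. lra.
    + rewrite T2, E. field. lra.
Qed.

Lemma is_derive_eq (f : R -> R) (x l l' : R) :
  is_derive f x l -> l = l' -> is_derive f x l'.
Proof. now intros H <-. Qed.

(** Minus the component along [(cos t, sin t, 0)] of the derivative of the
    surface in the direction of [s]. *)
Definition tangential (t s : R) : R := twist a t / a * cosh (phase a t s).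

Lemma is_derive_catenoid_t (t s : R) :
  is_derive (fun t => comp (catenoid a) A1 t s) t (exp (- s) * radius a t s * cos t) /\
  is_derive (fun t => comp (catenoid a) A2 t s) t (exp s * radius a t s * sin t) /\
  is_derive (fun t => comp (catenoid a) A3 t s) t 0.
Proof.
  destruct (is_derive_frame_t t s) as [D1 D2].
  unfold comp, catenoid, coord; simpl. split; [|split].
  - rewrite Rmult_assoc. now apply is_derive_scal.
  - rewrite Rmult_assoc. now apply is_derive_scal.
  - exact (@is_derive_const R_AbsRing R_NormedModule s t).
Qed.

Lemma is_derive_frame_s (t s : R) :
  is_derive (fun s => frame1 a t s) s
    (frame1 a t s - tangential t s * cos t - sinh (phase a t s) * sin t) /\
  is_derive (fun s => frame2 a t s) s
    (- frame2 a t s + sinh (phase a t s) * cos t - tangential t s * sin t).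
Proof.
  assert (Dr := is_derive_phase_s t s). unfold frame1, frame2, tangential.
  split; derive_frame; field; split; trivial.
Qed.

Lemma is_derive_catenoid_s (t s : R) :
  is_derive (fun s => comp (catenoid a) A1 t s) s
    (exp (- s) * (- tangential t s * cos t - sinh (phase a t s) * sin t)) /\
  is_derive (fun s => comp (catenoid a) A2 t s) s
    (exp s * (sinh (phase a t s) * cos t - tangential t s * sin t)) /\
  is_derive (fun s => comp (catenoid a) A3 t s) s 1.
Proof.
  destruct (is_derive_frame_s t s) as [D1 D2].
  unfold comp, catenoid, coord; simpl. split; [|split].
  - assert (De : is_derive (fun s => exp (- s)) s (- exp (- s))).
    { auto_derive; trivial. ring. }
    assert (D := is_derive_mult _ _ s _ _ De D1 Rmult_comm).
    eapply is_derive_eq; [exact D|]. unfold plus, mult; simpl. ring.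
  - assert (D := is_derive_mult _ _ s _ _ (is_derive_exp s) D2 Rmult_comm).
    eapply is_derive_eq; [exact D|]. unfold plus, mult; simpl. ring.
  - exact (@is_derive_id R_AbsRing s).
Qed.

End TangentVectors.

(** * Curvature in Sol3 *)

Lemma inner_sol p v w :
  inner p v w = exp (2 * coord A3 p) * coord A1 v * coord A1 w
    + exp (- (2 * coord A3 p)) * coord A2 v * coord A2 w + coord A3 v * coord A3 w.
Proof. unfold inner, sum3, metric. ring. Qed.

Lemma partial_metric i j k p :
  partial i (metric j k) p =
  match i, j, k with
  | A3, A1, A1 => 2 * exp (2 * coord A3 p)
  | A3, A2, A2 => - (2 * exp (- (2 * coord A3 p)))
  | _, _, _ => 0
  end.
Proof.
  unfold partial; apply is_derive_unique;
    destruct i, j, k; simpl; auto_derive; trivial; ring.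
Qed.

Lemma second_form_sol p Xa Xb Xab N :
  second_form p Xa Xb Xab N =
  exp (2 * coord A3 p) * coord A1 N *
    (coord A1 Xab + coord A1 Xa * coord A3 Xb + coord A3 Xa * coord A1 Xb)
  + exp (- (2 * coord A3 p)) * coord A2 N *
    (coord A2 Xab - coord A2 Xa * coord A3 Xb - coord A3 Xa * coord A2 Xb)
  + coord A3 N *
    (coord A3 Xab - exp (2 * coord A3 p) * coord A1 Xa * coord A1 Xb
     + exp (- (2 * coord A3 p)) * coord A2 Xa * coord A2 Xb).
Proof.
  unfold second_form, sum3, christoffel. rewrite inner_sol, !partial_metric.
  simpl. field.
Qed.

(** * Minimality *)

Section Minimality.

Variable a : R.
Hypothesis Ha : parameter a.

Let Ha1 : -1 < a < 1 := proj1 Ha.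
Let Ha0 : a <> 0 := proj2 Ha.

Let X := catenoid a.

Lemma du_catenoid :
  du (comp X A1) = (fun t s => exp (- s) * radius a t s * cos t) /\
  du (comp X A2) = (fun t s => exp s * radius a t s * sin t) /\
  du (comp X A3) = (fun _ _ => 0).
Proof.
  split; [|split]; extensionality t; extensionality s; apply is_derive_unique;
    apply (is_derive_catenoid_t a Ha t s).
Qed.

Lemma dv_catenoid :
  dv (comp X A1) = (fun t s =>
    exp (- s) * (- tangential a t s * cos t - sinh (phase a t s) * sin t)) /\
  dv (comp X A2) = (fun t s =>
    exp s * (sinh (phase a t s) * cos t - tangential a t s * sin t)) /\
  dv (comp X A3) = (fun _ _ => 1).
Proof.
  split; [|split]; extensionality t; extensionality s; apply is_derive_unique;
    apply (is_derive_catenoid_s a Ha t s).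
Qed.

Lemma exp_scale s : exp (2 * s) = exp s ^ 2 /\ exp (- (2 * s)) = exp (- s) ^ 2.
Proof.
  replace (2 * s) with (s + s) by ring. rewrite Ropp_plus_distr, !exp_plus.
  split; ring.
Qed.

Lemma exp_opp_mult s : exp s * exp (- s) = 1.
Proof. rewrite <- exp_plus, Rplus_opp_r. apply exp_0. Qed.

Lemma fE_catenoid t s : fE X t s = radius a t s ^ 2.
Proof.
  unfold fE, lift. rewrite inner_sol. simpl.
  destruct du_catenoid as (-> & -> & ->). destruct (exp_scale s) as [-> ->].
  (* the products of exponentials and the sum of squares are kept apart, so that
     they can be replaced by 1 *)
  transitivity ((exp s * exp (- s)) ^ 2 * radius a t s ^ 2 * (sin t ^ 2 + cos t ^ 2));
    [ring|]. rewrite exp_opp_mult, sin2_cos2'. ring.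
Qed.

Lemma fF_catenoid t s : fF X t s = - radius a t s * tangential a t s.
Proof.
  unfold fF, lift. rewrite inner_sol. simpl.
  destruct du_catenoid as (-> & -> & ->). destruct dv_catenoid as (-> & -> & ->).
  destruct (exp_scale s) as [-> ->].
  transitivity (- (exp s * exp (- s)) ^ 2 * radius a t s * tangential a t s
                * (sin t ^ 2 + cos t ^ 2)); [ring|].
  rewrite exp_opp_mult, sin2_cos2'. ring.
Qed.

Lemma fG_catenoid t s :
  fG X t s = tangential a t s ^ 2 + cosh (phase a t s) ^ 2.
Proof.
  rewrite cosh_sqr. unfold fG, lift. rewrite inner_sol. simpl.
  destruct dv_catenoid as (-> & -> & ->).
  destruct (exp_scale s) as [-> ->].
  transitivity ((exp s * exp (- s)) ^ 2 *
     (tangential a t s ^ 2 + sinh (phase a t s) ^ 2)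
                * (sin t ^ 2 + cos t ^ 2) + 1); [ring|].
  rewrite exp_opp_mult, sin2_cos2'. ring.
Qed.

Lemma tangential_cosh_sqr t s :
  tangential a t s ^ 2 + cosh (phase a t s) ^ 2
  = 2 / (1 + speed a t) * cosh (phase a t s) ^ 2.
Proof.
  assert (Hw := speed_pos a t Ha1). unfold tangential.
  transitivity ((a ^ 2 + twist a t ^ 2) / a ^ 2 * cosh (phase a t s) ^ 2);
    [field; trivial|].
  rewrite twist_sqr by trivial. field. split; trivial; lra.
Qed.

Lemma radius_neq t s : radius a t s <> 0.
Proof.
  assert (Hw := speed_pos a t Ha1). assert (Hc := cosh_pos (phase a t s)).
  unfold radius. apply Rmult_integral_contrapositive_currified.
  - apply Rmult_integral_contrapositive_currified; [|lra].
    apply Rmult_integral_contrapositive_currified; trivial; lra.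
  - apply Rinv_neq_0_compat. apply Rgt_not_eq. nra.
Qed.

Lemma catenoid_immersive t s : immersive X t s.
Proof.
  unfold immersive. rewrite fE_catenoid, fF_catenoid, fG_catenoid.
  replace (_ - _) with ((radius a t s * cosh (phase a t s)) ^ 2) by ring.
  apply pow2_gt_0. apply Rmult_integral_contrapositive_currified.
  - apply radius_neq.
  - apply Rgt_not_eq, cosh_pos.
Qed.

Lemma ex_derive_radius (t s : R) : ex_derive (fun t => radius a t s) t.
Proof.
  assert (Hw := speed_pos a t Ha1). assert (Dw := is_derive_speed a t Ha1).
  assert (Dr := is_derive_phase_t a Ha t s). unfold radius. auto_derive.
  repeat split; trivial; try (eexists; eassumption). apply Rgt_not_eq. nra.
Qed.

Lemma ex_derive_tangential (t s : R) : ex_derive (fun t => tangential a t s) t.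
Proof.
  assert (Dq := is_derive_twist a t Ha1).
  assert (Dr := is_derive_phase_t a Ha t s). unfold tangential. auto_derive.
  repeat split; trivial; eexists; eassumption.
Qed.

(** The derivatives [R1] of [radius] and [p1] of [tangential] are left
    unspecified: they only occur in tangential components, to which the second
    fundamental form is blind. *)
Lemma second_derivatives_catenoid (t s : R) : exists R1 p1 : R,
  (du (du (comp X A1)) t s = exp (- s) * (R1 * cos t - radius a t s * sin t) /\
   du (du (comp X A2)) t s = exp s * (R1 * sin t + radius a t s * cos t) /\
   du (du (comp X A3)) t s = 0) /\
  (let r1 := a * sin (2 * t) * (2 + speed a t) / (speed a t * (1 + speed a t)) in
   let ch := cosh (phase a t s) in let sh := sinh (phase a t s) in
   let p := tangential a t s in
   du (dv (comp X A1)) t s =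
     exp (- s) * (- p1 * cos t + p * sin t - r1 * ch * sin t - sh * cos t) /\
   du (dv (comp X A2)) t s =
     exp s * (r1 * ch * cos t - sh * sin t - p1 * sin t - p * cos t) /\
   du (dv (comp X A3)) t s = 0) /\
  (let ch := cosh (phase a t s) in let sh := sinh (phase a t s) in
   let p := tangential a t s in let ps := - (twist a t / a ^ 2 * sh) in
   dv (dv (comp X A1)) t s =
     exp (- s) * (p * cos t + sh * sin t - ps * cos t + ch / a * sin t) /\
   dv (dv (comp X A2)) t s =
     exp s * (sh * cos t - p * sin t - ch / a * cos t - ps * sin t) /\
   dv (dv (comp X A3)) t s = 0).
Proof.
  assert (DR := Derive_correct _ _ (ex_derive_radius t s)).
  assert (Dp := Derive_correct _ _ (ex_derive_tangential t s)).
  exists (Derive (fun t => radius a t s) t), (Derive (fun t => tangential a t s) t).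
  destruct du_catenoid as (-> & -> & ->). destruct dv_catenoid as (-> & -> & ->).
  assert (Dr := is_derive_phase_t a Ha t s). assert (Ds := is_derive_phase_s a Ha t s).
  unfold du, dv. repeat split; apply is_derive_unique.
  - auto_derive; [repeat split; trivial; eexists; eassumption|].
    ring.
  - auto_derive; [repeat split; trivial; eexists; eassumption|].
    ring.
  - exact (@is_derive_const R_AbsRing R_NormedModule 0 t).
  - auto_derive; [repeat split; trivial; eexists; eassumption|].
    rewrite_derive Dr. ring.
  - auto_derive; [repeat split; trivial; eexists; eassumption|].
    rewrite_derive Dr. ring.
  - exact (@is_derive_const R_AbsRing R_NormedModule 1 t).
  - unfold tangential. auto_derive; [repeat split; trivial; eexists; eassumption|].
    rewrite_derive Ds. field; trivial.
  - unfold tangential.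
    assert (D : is_derive (fun s => sinh (phase a t s) * cos t
        - twist a t / a * cosh (phase a t s) * sin t) s
        (- / a * (cosh (phase a t s) * cos t
         - twist a t / a * sinh (phase a t s) * sin t))).
    { auto_derive; [repeat split; trivial; eexists; eassumption|].
      rewrite_derive Ds. field; trivial. }
    assert (D' := is_derive_mult _ _ s _ _ (is_derive_exp s) D Rmult_comm).
    eapply is_derive_eq; [exact D'|]. unfold plus, mult; simpl. field; trivial.
  - exact (@is_derive_const R_AbsRing R_NormedModule 1 s).
Qed.

Lemma cos_sqr t : cos t ^ 2 = 1 - sin t ^ 2.
Proof. generalize (sin2_cos2' t). lra. Qed.

(** Equality of the two mixed second derivatives, in the direction of
    [(- sin t, cos t, 0)]. *)
Lemma cosh_phase_t t s :
  a * sin (2 * t) * (2 + speed a t) / (speed a t * (1 + speed a t))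
    * cosh (phase a t s)
  = radius a t s * sin (2 * t) + tangential a t s.
Proof.
  assert (Hw := speed_pos a t Ha1). unfold radius, tangential, twist.
  field. repeat split; trivial; lra.
Qed.

(** Once the normal direction [(- sin t, cos t, - sinh phase)] is inserted, the
    mean curvature is this expression times a factor. *)
Lemma radius_balance t s :
  cosh (phase a t s) * ((twist a t / a) ^ 2 + 1)
  + radius a t s * (twist a t / a) * sin (2 * t) - radius a t s * / a = 0.
Proof.
  assert (Hw := speed_pos a t Ha1).
  transitivity (cosh (phase a t s) * (a ^ 2 + twist a t ^ 2) / a ^ 2
    - radius a t s * (1 - twist a t * sin (2 * t)) / a).
  - field; trivial.
  - rewrite twist_sqr, twist_sin by trivial. unfold radius.
    field. repeat split; trivial; lra.
Qed.

(** Every normal vector [N] is [mu] times [(- sin t, cos t, - sinh phase)] in the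
    orthonormal frame, hence the numerator of the mean curvature is a polynomial
    in the sine and cosine of [t] and the hyperbolic functions of [phase]. *)
Lemma catenoid_minimal : minimal_immersion X.
Proof.
  intros t s N (_ & Nt & Ns). unfold mean_curvature.
  rewrite !second_form_sol, fE_catenoid, fF_catenoid, fG_catenoid.
  rewrite inner_sol in Nt, Ns. unfold lift in *.
  destruct (second_derivatives_catenoid t s)
    as (R1 & p1 & (U1 & U2 & U3) & (V1 & V2 & V3) & (W1 & W2 & W3)).
  simpl in *. rewrite U1, U2, U3, V1, V2, V3, W1, W2, W3. clear U1 U2 U3 V1 V2 V3 W1 W2 W3.
  destruct du_catenoid as (E1 & E2 & E3). destruct dv_catenoid as (F1 & F2 & F3).
  rewrite E1, E2, E3, F1, F2, F3 in *. clear E1 E2 E3 F1 F2 F3.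
  destruct (exp_scale s) as [Ee Ef]. rewrite Ee, Ef in *. clear Ee Ef.
  assert (Hef := exp_opp_mult s). assert (Hch := cosh_sqr (phase a t s)).
  assert (Htr := cos_sqr t). assert (HR := radius_neq t s).
  assert (H1 := cosh_phase_t t s). assert (H2 := radius_balance t s).
  set (w := speed a t) in *. set (r1 := a * sin (2 * t) * (2 + w) / (w * (1 + w))) in *.
  unfold tangential in *. rewrite sin_2a in H1, H2.
  set (ch := cosh (phase a t s)) in *. set (sh := sinh (phase a t s)) in *.
  set (e := exp s) in *. set (f := exp (- s)) in *.
  replace (twist a t / (a * (a * 1))) with (twist a t / a * / a) by (field; trivial).
  set (g := twist a t / a) in *. set (si := sin t) in *. set (co := cos t) in *.
  set (R0 := radius a t s) in *.
  (* mu is the component of N along (- sin t, cos t, 0) *)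
  set (mu := f * snd (fst N) * co - e * fst (fst N) * si).
  unfold Rdiv at 1. apply Rmult_eq_0_compat_r.
  assert (Nt' : e * fst (fst N) * co + f * snd (fst N) * si = 0).
  { apply (Rmult_eq_reg_l R0); trivial. rewrite Rmult_0_r, <- Nt.
    ring [Hef]. }
  assert (N1 : fst (fst N) = - mu * f * si).
  { unfold mu.
    transitivity (co * f * (e * fst (fst N) * co + f * snd (fst N) * si) - mu * f * si).
    - unfold mu. ring [Hef Htr].
    - rewrite Nt'. unfold mu. ring. }
  assert (N2 : snd (fst N) = mu * e * co).
  { transitivity (si * e * (e * fst (fst N) * co + f * snd (fst N) * si) + mu * e * co).
    - unfold mu. ring [Hef Htr].
    - rewrite Nt'. unfold mu. ring. }
  assert (N3 : snd N = - mu * sh).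
  { rewrite N1, N2 in Ns. apply Rminus_diag_uniq. rewrite <- Ns. ring [Hef Htr]. }
  rewrite N1, N2, N3. clearbody mu. clear N1 N2 N3 Nt Ns Nt'. 
  transitivity (mu * R0 * ch * (ch * (g ^ 2 + 1) + R0 * g * (2 * si * co) - R0 * / a)).
  - rewrite H1. unfold Rdiv. clear H1 H2. clearbody g. ring [Hef Hch Htr].
  - rewrite H2. ring.
Qed.

End Minimality.

Section Smoothness.

Variable a : R.
Hypothesis Ha : parameter a.

Let Ha1 : -1 < a < 1 := proj1 Ha.
Let Ha0 : a <> 0 := proj2 Ha.

(** * Smoothness *)

(** The inverses are included because they occur in the derivatives of [speed]
    and [phase]. *)
Inductive catenoid_gen : (R -> R -> R) -> Prop :=
| gen_sin : catenoid_gen (fun t _ => sin t)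
| gen_cos : catenoid_gen (fun t _ => cos t)
| gen_speed : catenoid_gen (fun t _ => speed a t)
| gen_twist : catenoid_gen (fun t _ => twist a t)
| gen_inv_speed : catenoid_gen (fun t _ => / speed a t)
| gen_inv_speed_1 : catenoid_gen (fun t _ => / (1 + speed a t))
| gen_cosh : catenoid_gen (fun t s => cosh (phase a t s))
| gen_sinh : catenoid_gen (fun t s => sinh (phase a t s))
| gen_exp : catenoid_gen (fun _ s => exp s)
| gen_exp_opp : catenoid_gen (fun _ s => exp (- s))
| gen_height : catenoid_gen (fun _ s => s).

Ltac prove_poly :=
  solve [apply poly_gen; constructor]
  || match goal with
     | |- poly _ (fun _ _ => _ + _) => apply poly_plus; prove_poly
     | |- poly _ (fun _ _ => _ - _) => apply poly_minus; prove_poly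
     | |- poly _ (fun _ _ => - _) => apply poly_opp; prove_poly
     | |- poly _ (fun _ _ => _ * _) => apply poly_mult; prove_poly
     | |- poly _ _ => apply poly_const
     end.

Lemma differentiable_phase t s :
  differentiable_pt_lim (phase a) t s
    (a * (2 * sin t * cos t) * (2 + speed a t) * / speed a t * / (1 + speed a t))
    (- / a).
Proof.
  assert (Hw := speed_pos a t Ha1).
  assert (D := is_derive_phase_t a Ha t 0). rewrite sin_2a in D.
  apply is_derive_Reals in D. apply (differentiable_pt_lim_proj1_0 _ t s) in D.
  assert (D' := differentiable_pt_lim_plus _ _ _ _ _ _ _ _ D
                  (differentiable_pt_lim_linear 0 (- / a) 0 t s)).
  replace (_ * _ * _ * _ * _) with
    (a * (2 * sin t * cos t) * (2 + speed a t) / (speed a t * (1 + speed a t)) + 0)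
    by (field; lra).
  replace (- / a) with (0 + - / a) by ring.
  eapply differentiable_pt_lim_ext; [|exact D'].
  apply locally_2d_forall. intros u v. unfold phase. field. trivial.
Qed.

Lemma catenoid_gen_closed :
  derivation_closed (fun _ _ => True) (poly catenoid_gen).
Proof.
  apply poly_derivation_closed.
  assert (Hfst : forall (f : R -> R) (fx : R -> R -> R),
    poly catenoid_gen fx -> (forall t s, is_derive f t (fx t s)) ->
    exists fx fy, poly catenoid_gen fx /\ poly catenoid_gen fy /\
      forall t s, True -> differentiable_pt_lim (fun t _ => f t) t s (fx t s) (fy t s)).
  { intros f fx Kx D. exists fx, (fun _ _ => 0).
    split; [trivial | split; [apply poly_const|]].
    intros t s _. apply differentiable_pt_lim_proj1_0, is_derive_Reals, D. }
  assert (Hsnd : forall (f : R -> R) (fy : R -> R -> R),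
    poly catenoid_gen fy -> (forall t s, is_derive f s (fy t s)) ->
    exists fx fy, poly catenoid_gen fx /\ poly catenoid_gen fy /\
      forall t s, True -> differentiable_pt_lim (fun _ s => f s) t s (fx t s) (fy t s)).
  { intros f fy Ky D. exists (fun t s => fy t s * 0), fy.
    split; [apply poly_mult; [trivial | apply poly_const] | split; trivial].
    intros t s _. replace (fy t s) with (fy t s * 1) at 2 by ring.
    apply (differentiable_pt_lim_comp1 f (fun _ v => v)); trivial.
    apply differentiable_pt_lim_snd. }
  assert (Hphase : forall g g' : R -> R, (forall x, is_derive g x (g' x)) ->
    poly catenoid_gen (fun t s => g' (phase a t s)) ->
    exists fx fy, poly catenoid_gen fx /\ poly catenoid_gen fy /\
      forall t s, True ->
      differentiable_pt_lim (fun t s => g (phase a t s)) t s (fx t s) (fy t s)).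
  { intros g g' D K.
    exists (fun t s => g' (phase a t s) * (a * (2 * sin t * cos t) * (2 + speed a t)
                        * / speed a t * / (1 + speed a t))),
           (fun t s => g' (phase a t s) * (- / a)).
    split; [apply poly_mult; [trivial | prove_poly] |
    split; [apply poly_mult; [trivial | prove_poly] |]].
    intros t s _. apply (differentiable_pt_lim_comp1 g (phase a)); trivial.
    apply differentiable_phase. }
  assert (Dw : forall t, is_derive (speed a) t
    (-2 * a * a * (2 * sin t * cos t) * (cos t * cos t - sin t * sin t) * / speed a t)).
  { intros t. eapply is_derive_eq; [now apply is_derive_speed|].
    rewrite sin_2a, cos_2a. unfold Rdiv. ring. }
  intros f [ | | | | | | | | | | ].
  - apply (Hfst sin (fun t _ => cos t)); [prove_poly|].
    intros t _. apply is_derive_Reals, derivable_pt_lim_sin.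
  - apply (Hfst cos (fun t _ => - sin t)); [prove_poly|].
    intros t _. apply is_derive_Reals, derivable_pt_lim_cos.
  - eapply (Hfst (speed a)); [|intros t s; apply Dw]. simpl. prove_poly.
  - eapply (Hfst (twist a) (fun t _ => 2 * a * a * (cos t * cos t - sin t * sin t)
      * / speed a t * / (1 + speed a t))); [prove_poly|].
    intros t _. assert (Hw := speed_pos a t Ha1).
    eapply is_derive_eq; [now apply is_derive_twist|].
    rewrite cos_2a. field. lra.
  - apply (Hfst (fun t => / speed a t) (fun t _ =>
      2 * a * a * (2 * sin t * cos t) * (cos t * cos t - sin t * sin t) * / speed a t
      * / speed a t * / speed a t)); [prove_poly|].
    intros t _. assert (Hw := speed_pos a t Ha1).
    assert (D := is_derive_inv _ _ _ (Dw t) (Rgt_not_eq _ _ Hw)).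
    eapply is_derive_eq; [exact D|]. field. lra.
  - apply (Hfst (fun t => / (1 + speed a t)) (fun t _ =>
      2 * a * a * (2 * sin t * cos t) * (cos t * cos t - sin t * sin t) * / speed a t
      * / (1 + speed a t) * / (1 + speed a t))); [prove_poly|].
    intros t _. assert (Hw := speed_pos a t Ha1). assert (D := Dw t).
    auto_derive; [split; [eexists; apply D | split; trivial; lra]|].
    rewrite_derive D. field. lra.
  - apply (Hphase cosh sinh); [|prove_poly].
    intros x. apply is_derive_Reals, derivable_pt_lim_cosh.
  - apply (Hphase sinh cosh); [|prove_poly].
    intros x. apply is_derive_Reals, derivable_pt_lim_sinh.
  - apply (Hsnd exp (fun _ s => exp s)); [prove_poly|].
    intros _ s. apply is_derive_exp.
  - apply (Hsnd (fun s => exp (- s)) (fun _ s => - exp (- s))); [prove_poly|].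
    intros _ s. auto_derive; trivial. ring.
  - apply (Hsnd (fun s => s) (fun _ s => 1)); [prove_poly|].
    intros _ s. exact (@is_derive_id R_AbsRing s).
Qed.

Lemma poly_catenoid i : poly catenoid_gen (comp (catenoid a) i).
Proof.
  destruct i; unfold comp, catenoid, coord, frame1, frame2, Rdiv; simpl; prove_poly.
Qed.

Lemma catenoid_smooth i : smooth_on (fun _ _ => True) (comp (catenoid a) i).
Proof.
  apply (derivation_closed_smooth _ (poly catenoid_gen)).
  - intros x y _. now apply locally_2d_forall.
  - apply catenoid_gen_closed.
  - apply poly_catenoid.
Qed.

End Smoothness.

(** * Symmetries *)

Lemma periodic_Z (A : Type) (f : R -> A) (T : R) :
  (forall x, f (x + T) = f x) -> forall (k : Z) x, f (x + T * IZR k) = f x.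
Proof.
  intros Hf.
  assert (Hn : forall n x, f (x + T * INR n) = f x).
  { induction n as [|n IH]; intros x.
    - simpl. f_equal. ring.
    - rewrite S_INR. replace (x + T * (INR n + 1)) with (x + T * INR n + T) by ring.
      now rewrite Hf. }
  intros k x. destruct (Z_le_gt_dec 0 k) as [Hk|Hk].
  - rewrite <- (Z2Nat.id k Hk), <- INR_IZR_INZ. apply Hn.
  - rewrite <- (Hn (Z.to_nat (- k)) (x + T * IZR k)), INR_IZR_INZ, Z2Nat.id by lia.
    rewrite opp_IZR. f_equal. ring.
Qed.

Lemma sin_cos_turn x : sin (x + 2 * PI) = sin x /\ cos (x + 2 * PI) = cos x.
Proof.
  replace (x + 2 * PI) with (x + PI + PI) by ring.
  rewrite !neg_sin, !neg_cos. split; ring.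
Qed.

Lemma sin_cos_double_half_turn t :
  sin (2 * (t + PI)) = sin (2 * t) /\ cos (2 * (t + PI)) = cos (2 * t).
Proof.
  replace (2 * (t + PI)) with (2 * t + PI + PI) by ring.
  rewrite !neg_sin, !neg_cos. split; ring.
Qed.

Lemma sin_cos_double_opp t :
  sin (2 * - t) = - sin (2 * t) /\ cos (2 * - t) = cos (2 * t).
Proof.
  replace (2 * - t) with (- (2 * t)) by ring. rewrite sin_neg, cos_neg. now split.
Qed.

Lemma angular_half_turn a t : speed a (t + PI) = speed a t /\
  twist a (t + PI) = twist a t /\ shift a (t + PI) = shift a t /\
  forall s, phase a (t + PI) s = phase a t s.
Proof.
  unfold phase, lag, shift, twist, speed.
  destruct (sin_cos_double_half_turn t) as [-> ->]. now repeat split.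
Qed.

Lemma angular_opp a t : speed a (- t) = speed a t /\
  twist a (- t) = - twist a t /\ forall s, phase a (- t) s = phase a t s.
Proof.
  unfold phase, lag, shift, twist, speed.
  destruct (sin_cos_double_opp t) as [-> ->].
  replace ((a * - sin (2 * t)) ^ 2) with ((a * sin (2 * t)) ^ 2) by ring.
  repeat split. unfold Rdiv. ring.
Qed.

Lemma speed_periodic a t : speed a (t + 2 * PI) = speed a t.
Proof.
  replace (t + 2 * PI) with (t + PI + PI) by ring.
  destruct (angular_half_turn a (t + PI)) as [-> _].
  now destruct (angular_half_turn a t) as [-> _].
Qed.

Lemma frame_half_turn a t s :
  frame1 a (t + PI) s = - frame1 a t s /\ frame2 a (t + PI) s = - frame2 a t s.
Proof.
  unfold frame1, frame2. destruct (angular_half_turn a t) as (_ & -> & _ & ->).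
  rewrite neg_sin, neg_cos. unfold Rdiv. split; ring.
Qed.

Lemma frame_opp a t s :
  frame1 a (- t) s = - frame1 a t s /\ frame2 a (- t) s = frame2 a t s.
Proof.
  unfold frame1, frame2. destruct (angular_opp a t) as (_ & -> & ->).
  rewrite sin_neg, cos_neg. unfold Rdiv. split; ring.
Qed.

Lemma frame_periodic a t s :
  frame1 a (t + 2 * PI) s = frame1 a t s /\ frame2 a (t + 2 * PI) s = frame2 a t s.
Proof.
  replace (t + 2 * PI) with (t + PI + PI) by ring.
  destruct (frame_half_turn a (t + PI) s) as [-> ->].
  destruct (frame_half_turn a t s) as [-> ->]. split; ring.
Qed.

Lemma catenoid_periodic a t s : catenoid a (t + 2 * PI) s = catenoid a t s.
Proof. unfold catenoid. now destruct (frame_periodic a t s) as [-> ->]. Qed.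

Definition catenoid_set (a : R) (p : point) : Prop :=
  exists t s, catenoid a t s = p.

Lemma invariant_under_involution (f : point -> point) (S : point -> Prop) :
  (forall p, f (f p) = p) -> (forall p, S p -> S (f p)) -> invariant_under f S.
Proof.
  intros Hf HS q. split.
  - intros Hq. exists (f q). auto.
  - intros (p & Hp & <-). auto.
Qed.

Lemma catenoid_set_rotation a : invariant_under rotation_x3 (catenoid_set a).
Proof.
  apply invariant_under_involution.
  - intros [[x y] z]. unfold rotation_x3. simpl. now rewrite !Ropp_involutive.
  - intros p (t & s & <-). exists (t + PI), s.
    unfold catenoid, rotation_x3. simpl.
    destruct (frame_half_turn a t s) as [-> ->]. now rewrite !Ropp_mult_distr_r.
Qed.

Lemma catenoid_set_reflection_x1 a : invariant_under reflection_x1 (catenoid_set a).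
Proof.
  apply invariant_under_involution.
  - intros [[x y] z]. unfold reflection_x1. simpl. now rewrite !Ropp_involutive.
  - intros p (t & s & <-). exists (- t), s.
    unfold catenoid, reflection_x1. simpl.
    destruct (frame_opp a t s) as [-> ->]. now rewrite !Ropp_mult_distr_r.
Qed.

Lemma catenoid_set_reflection_x2 a : invariant_under reflection_x2 (catenoid_set a).
Proof.
  apply invariant_under_involution.
  - intros [[x y] z]. unfold reflection_x2. simpl. now rewrite !Ropp_involutive.
  - intros p (t & s & <-). exists (- t + PI), s.
    unfold catenoid, reflection_x2. simpl.
    destruct (frame_half_turn a (- t) s) as [-> ->].
    destruct (frame_opp a t s) as [-> ->].
    now rewrite !Ropp_mult_distr_r, Ropp_involutive.
Qed.

(** * Horizontal sections *)

Lemma shift_into_period (t s : R) :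
  exists k : Z, t <= s + 2 * PI * IZR k < t + 2 * PI.
Proof.
  assert (HP := PI_RGT_0).
  destruct (archimed ((t - s) / (2 * PI))) as [H1 H2].
  set (k := up ((t - s) / (2 * PI))) in *.
  apply (Rmult_lt_compat_l (2 * PI)) in H1; [|lra].
  apply (Rmult_le_compat_l (2 * PI)) in H2; [|lra].
  replace (2 * PI * ((t - s) / (2 * PI))) with (t - s) in H1 by (field; lra).
  replace (2 * PI * (IZR k - (t - s) / (2 * PI)))
    with (2 * PI * IZR k - (t - s)) in H2 by (field; lra).
  destruct (Rlt_le_dec (s + 2 * PI * IZR k) (t + 2 * PI)).
  - exists k. lra.
  - exists (k - 1)%Z. rewrite minus_IZR. lra.
Qed.

Section HorizontalSections.

Variable a : R.
Hypothesis Ha : parameter a.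

Let Ha1 : -1 < a < 1 := proj1 Ha.
Let Ha0 : a <> 0 := proj2 Ha.

(** Signed distance in the flat metric of the section, divided by [a], from the
    point of angle [t'] to the tangent line at the point of angle [t]. *)
Definition gap (s t t' : R) : R :=
  (cos t * (frame2 a t' s - frame2 a t s) - sin t * (frame1 a t' s - frame1 a t s)) / a.

Lemma radius_div_pos t s : 0 < radius a t s / a.
Proof.
  assert (Hw := speed_pos a t Ha1). assert (Hc := cosh_pos (phase a t s)).
  replace (radius a t s / a)
    with (2 * cosh (phase a t s) / (speed a t * (1 + speed a t)))
    by (unfold radius; field; repeat split; trivial; lra).
  apply Rdiv_lt_0_compat; nra.
Qed.

Lemma is_derive_gap (s t t' : R) :
  is_derive (gap s t) t' (radius a t' s / a * sin (t' - t)).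
Proof.
  destruct (is_derive_frame_t a Ha t' s) as [D1 D2].
  unfold gap. auto_derive.
  - split; [eexists; apply D2 | split; [eexists; apply D1 | trivial]].
  - rewrite_derive D1. rewrite_derive D2. rewrite sin_minus. field. trivial.
Qed.

Lemma gap_periodic s t t' : gap s t (t' + 2 * PI) = gap s t t'.
Proof. unfold gap. now destruct (frame_periodic a t' s) as [-> ->]. Qed.

Lemma gap_refl s t : gap s t t = 0.
Proof. unfold gap. field. trivial. Qed.

(** The gap increases while the tangent turns by less than a half turn, then
    decreases until it is back at 0. *)
Lemma gap_pos_period s t t' : t < t' < t + 2 * PI -> 0 < gap s t t'.
Proof.
  intros Ht. assert (HP := PI_RGT_0).
  assert (D : forall x, derivable_pt_lim (gap s t) x (radius a x s / a * sin (x - t))).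
  { intros x. apply is_derive_Reals, is_derive_gap. }
  destruct (Rle_lt_dec t' (t + PI)) as [H|H].
  - destruct (MVT_cor2 (gap s t) _ t t' (proj1 Ht) (fun x _ => D x)) as (x & E & Hx).
    rewrite gap_refl, Rminus_0_r in E. rewrite E.
    apply Rmult_lt_0_compat; [|lra]. apply Rmult_lt_0_compat.
    + apply radius_div_pos.
    + apply sin_gt_0; lra.
  - destruct (MVT_cor2 (gap s t) _ t' (t + 2 * PI) (proj2 Ht) (fun x _ => D x))
      as (x & E & Hx).
    rewrite gap_periodic, gap_refl in E.
    assert (sin (x - t) < 0) by (apply sin_lt_0; lra).
    assert (Hr := radius_div_pos x s).
    assert (radius a x s / a * sin (x - t) < 0) by nra. nra.
Qed.

Lemma gap_pos s t t' : 0 < gap s t t' \/ exists k : Z, t' = t + 2 * PI * IZR k.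
Proof.
  destruct (shift_into_period t t') as [k Hk].
  rewrite <- (periodic_Z _ _ _ (gap_periodic s t) k t').
  destruct (Rle_lt_or_eq_dec _ _ (proj1 Hk)) as [H|H].
  - left. apply gap_pos_period. lra.
  - right. exists (- k)%Z. rewrite opp_IZR. lra.
Qed.

Lemma gap_nonneg s t t' : 0 <= gap s t t'.
Proof.
  destruct (gap_pos s t t') as [H | [k ->]]; [lra|].
  rewrite (periodic_Z _ _ _ (gap_periodic s t)), gap_refl. lra.
Qed.

(** A double point would lie on the tangent line of the curve at itself. *)
Lemma frame_injective s t t' :
  frame1 a t s = frame1 a t' s -> frame2 a t s = frame2 a t' s ->
  exists k : Z, t' = t + 2 * PI * IZR k.
Proof.
  intros E1 E2. destruct (gap_pos s t t') as [H | H]; trivial.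
  exfalso. revert H. unfold gap. rewrite E1, E2. unfold Rdiv. lra.
Qed.

Lemma catenoid_injective t s t' s' :
  catenoid a t s = catenoid a t' s' ->
  s = s' /\ exists k : Z, t' = t + 2 * PI * IZR k.
Proof.
  unfold catenoid. intros E. injection E. intros <- E2 E1. split; trivial.
  apply (frame_injective s).
  - apply Rmult_eq_reg_l in E1; trivial. apply Rgt_not_eq, exp_pos.
  - apply Rmult_eq_reg_l in E2; trivial. apply Rgt_not_eq, exp_pos.
Qed.

(** Properness is immediate: the parameter [s] is the third coordinate. *)
Lemma catenoid_proper_embedding : proper_annulus_embedding (catenoid a).
Proof.
  split; [|split; [|split; [|split]]].
  - intros i. now apply catenoid_smooth.
  - apply catenoid_periodic.
  - now apply catenoid_immersive.
  - apply catenoid_injective.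
  - intros M. exists M. intros t s H. apply (H A3).
Qed.

Lemma catenoid_section_convex lambda :
  closed_embedded_convex_curve (fun x1 x2 => catenoid_set a (x1, x2, lambda)).
Proof.
  set (c1 := fun t => exp (- lambda) * frame1 a t lambda).
  set (c2 := fun t => exp lambda * frame2 a t lambda).
  assert (D1 : forall t, Derive c1 t = exp (- lambda) * radius a t lambda * cos t).
  { intros t. apply is_derive_unique. apply (is_derive_catenoid_t a Ha t lambda). }
  assert (D2 : forall t, Derive c2 t = exp lambda * radius a t lambda * sin t).
  { intros t. apply is_derive_unique. apply (is_derive_catenoid_t a Ha t lambda). }
  exists c1, c2. split; [|split; [|split; [|split; [|split]]]].
  - intros n t.
    assert (H := fun i => derivation_closed_slice _ (catenoid_gen_closed a Ha) _
                            (poly_catenoid a i) n t lambda).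
    split; [exact (H A1) | exact (H A2)].
  - intros t. unfold c1, c2. now destruct (frame_periodic a t lambda) as [-> ->].
  - intros t. rewrite D1, D2. assert (HR := radius_neq a Ha t lambda).
    assert (Hm : forall x z, z <> 0 -> exp x * radius a t lambda * z <> 0).
    { intros x z Hz. apply Rmult_integral_contrapositive_currified; trivial.
      apply Rmult_integral_contrapositive_currified; trivial.
      apply Rgt_not_eq, exp_pos. }
    destruct (Req_dec (cos t) 0) as [E|E]; [right | left; auto].
    apply Hm. intros E'. generalize (sin2_cos2' t). rewrite E, E'. lra.
  - intros t t' E1 E2. apply (catenoid_injective t lambda t' lambda).
    unfold catenoid. fold (c1 t) (c1 t') (c2 t) (c2 t'). now rewrite E1, E2.
  - intros x y. unfold catenoid_set, catenoid. split.
    + intros (t & s & E). injection E. intros -> <- <-. now exists t.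
    + intros (t & <- & <-). now exists t, lambda.
  - intros side t. left. intros t'. unfold side. rewrite D1, D2. unfold c1, c2.
    replace (_ - _) with
      (exp lambda * exp (- lambda) * a ^ 2 * (radius a t lambda / a) * gap lambda t t')
      by (unfold gap; field; trivial).
    rewrite exp_opp_mult. apply Rmult_le_pos; [|apply gap_nonneg].
    apply Rmult_le_pos; [|left; apply radius_div_pos]. nra.
Qed.

(** The tangent is parallel to the [x1]-axis at the angles 0 and [PI], hence the
    section lies between its tangent lines there. *)
Lemma frame2_max t s : Rabs (frame2 a t s) <= Rabs (frame2 a 0 s).
Proof.
  assert (H1 := gap_nonneg s 0 t). assert (H2 := gap_nonneg s (0 + PI) t).
  unfold gap in H1, H2. destruct (frame_half_turn a 0 s) as [E1 E2].
  rewrite E1, E2, neg_cos, neg_sin in H2. rewrite cos_0, sin_0 in *.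
  replace (frame2 a t s) with (a * (frame2 a t s / a)) by (field; trivial).
  replace (frame2 a 0 s) with (a * (frame2 a 0 s / a)) by (field; trivial).
  rewrite !Rabs_mult. apply Rmult_le_compat_l; [apply Rabs_pos|].
  replace (_ / a) with (frame2 a t s / a - frame2 a 0 s / a) in H1 by (field; trivial).
  replace (_ / a) with (- (frame2 a t s / a) - frame2 a 0 s / a) in H2
    by (field; trivial).
  rewrite (Rabs_left1 (frame2 a 0 s / a)) by lra.
  apply Rabs_le. lra.
Qed.

End HorizontalSections.

(** * Dependence on the parameter *)

Lemma continuous_apply {U : UniformSpace} (g : R -> R) (f : U -> R) (x : U) :
  continuous f x -> ex_derive g (f x) -> continuous (fun y => g (f y)) x.
Proof.
  intros Hf Hg. apply (continuous_comp f g); trivial. now apply @ex_derive_continuous.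
Qed.

Lemma continuous_Rplus {U : UniformSpace} (f g : U -> R) (x : U) :
  continuous f x -> continuous g x -> continuous (fun y => f y + g y) x.
Proof. apply (continuous_plus (V := R_NormedModule)). Qed.

Lemma continuous_Ropp {U : UniformSpace} (f : U -> R) (x : U) :
  continuous f x -> continuous (fun y => - f y) x.
Proof. apply (continuous_opp (V := R_NormedModule)). Qed.

Lemma continuous_Rminus {U : UniformSpace} (f g : U -> R) (x : U) :
  continuous f x -> continuous g x -> continuous (fun y => f y - g y) x.
Proof. apply (continuous_minus (V := R_NormedModule)). Qed.

Lemma continuous_Rmult {U : UniformSpace} (f g : U -> R) (x : U) :
  continuous f x -> continuous g x -> continuous (fun y => f y * g y) x.
Proof. apply (continuous_mult (K := R_AbsRing)). Qed.

Lemma continuous_Rdiv {U : UniformSpace} (f g : U -> R) (x : U) :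
  continuous f x -> continuous g x -> g x <> 0 -> continuous (fun y => f y / g y) x.
Proof.
  intros Hf Hg Hx. apply continuous_Rmult; trivial.
  apply (continuous_apply Rinv); trivial. now auto_derive.
Qed.

Lemma continuous_Rpow {U : UniformSpace} (f : U -> R) (n : nat) (x : U) :
  continuous f x -> continuous (fun y => f y ^ n) x.
Proof.
  intros Hf. apply (continuous_apply (fun y => y ^ n)); trivial. now auto_derive.
Qed.

Ltac prove_continuous :=
  match goal with
  | H : continuous _ ?x |- continuous _ ?x => exact H
  | |- continuous (fun _ => ?c) _ => apply continuous_const
  | |- continuous (fun _ => _ + _) _ => apply continuous_Rplus; prove_continuous
  | |- continuous (fun _ => _ - _) _ => apply continuous_Rminus; prove_continuous
  | |- continuous (fun _ => - _) _ => apply continuous_Ropp; prove_continuous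
  | |- continuous (fun _ => _ * _) _ => apply continuous_Rmult; prove_continuous
  | |- continuous (fun _ => _ / _) _ =>
      apply continuous_Rdiv; [prove_continuous | prove_continuous | simpl; trivial; try lra]
  | |- continuous (fun _ => _ ^ _) _ => apply continuous_Rpow; prove_continuous
  | |- continuous (fun y => sin (@?f y)) _ =>
      apply (continuous_apply sin f); [prove_continuous | now auto_derive]
  | |- continuous (fun y => cos (@?f y)) _ =>
      apply (continuous_apply cos f); [prove_continuous | now auto_derive]
  | |- continuous (fun y => exp (@?f y)) _ =>
      apply (continuous_apply exp f); [prove_continuous | now auto_derive]
  | |- continuous (fun y => cosh (@?f y)) _ =>
      apply (continuous_apply cosh f); [prove_continuous | now auto_derive]
  | |- continuous (fun y => sinh (@?f y)) _ =>
      apply (continuous_apply sinh f); [prove_continuous | now auto_derive]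
  | |- continuous (fun y => sqrt (@?f y)) _ =>
      apply (continuous_apply sqrt f); [prove_continuous | auto_derive; simpl; trivial]
  | |- continuous (fun y => ln (@?f y)) _ =>
      apply (continuous_apply ln f); [prove_continuous | auto_derive; simpl; trivial]
  end.

Lemma catenoid_continuous i (a t s : R) : parameter a ->
  continuous (fun q : R * R * R =>
    coord i (catenoid (fst (fst q)) (snd (fst q)) (snd q))) (a, t, s).
Proof.
  intros [Ha1 Ha0].
  assert (C1 : continuous (fun q : R * R * R => fst (fst q)) (a, t, s)).
  { apply (continuous_comp fst fst); apply continuous_fst. }
  assert (C2 : continuous (fun q : R * R * R => snd (fst q)) (a, t, s)).
  { apply (continuous_comp fst snd); [apply continuous_fst | apply continuous_snd]. }
  assert (C3 : continuous (fun q : R * R * R => snd q) (a, t, s))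
    by apply continuous_snd.
  assert (Hw := speed_pos a t Ha1). assert (Hk := square_lt_1 a Ha1).
  destruct (shift_arguments_pos a t Ha1) as [P1 P2].
  assert (P3 := lag_argument_pos a t Ha1).
  assert (P4 := speed_radicand_pos a t Ha1).
  assert (Cw : continuous (fun q : R * R * R =>
            speed (fst (fst q)) (snd (fst q))) (a, t, s)).
  { unfold speed. prove_continuous. }
  assert (Cq : continuous (fun q : R * R * R =>
            twist (fst (fst q)) (snd (fst q))) (a, t, s)).
  { unfold twist. prove_continuous. }
  assert (Cr : continuous (fun q : R * R * R =>
            phase (fst (fst q)) (snd (fst q)) (snd q)) (a, t, s)).
  { unfold phase, shift, lag. prove_continuous. }
  destruct i; unfold coord, catenoid, frame1, frame2; simpl fst; simpl snd;
    prove_continuous.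
Qed.

(** The weights are those of [cosh phase + a sinh phase], which is the value of
    [frame2] at the angle 0 up to a constant factor. *)
Lemma frame2_0_growth a : parameter a -> exists c d, 0 < c /\ 0 < d /\
  forall s, Rabs (frame2 a 0 s) = c * exp (s / a) + d * exp (- (s / a)).
Proof.
  intros [Ha1 Ha0]. assert (Hk := square_lt_1 a Ha1).
  set (r0 := shift a 0 / a - lag a 0). set (m := Rabs a / (2 * (1 - a ^ 2))).
  assert (Hm : 0 < m).
  { apply Rdiv_lt_0_compat; [now apply Rabs_pos_lt | lra]. }
  exists (m * (1 - a) * exp (- r0)), (m * (1 + a) * exp r0).
  assert (E1 := exp_pos r0). assert (E2 := exp_pos (- r0)).
  split; [|split].
  - apply Rmult_lt_0_compat; trivial. apply Rmult_lt_0_compat; lra.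
  - apply Rmult_lt_0_compat; trivial. apply Rmult_lt_0_compat; lra.
  - intros s.
    replace (frame2 a 0 s) with
      (- (a * (((1 + a) * exp (phase a 0 s) + (1 - a) * exp (- phase a 0 s))
              / (2 * (1 - a ^ 2))))).
    + assert (H1 := exp_pos (phase a 0 s)). assert (H2 := exp_pos (- phase a 0 s)).
      rewrite Rabs_Ropp, Rabs_mult.
      rewrite (Rabs_pos_eq (_ / _)).
      * replace (phase a 0 s) with (r0 + - (s / a)) by (unfold r0, phase; field; trivial).
        rewrite Ropp_plus_distr, Ropp_involutive, !exp_plus. unfold m. field. lra.
      * left. apply Rdiv_lt_0_compat; [|lra].
        apply Rplus_lt_0_compat; apply Rmult_lt_0_compat; lra.
    + unfold frame2, twist, cosh, sinh. rewrite Rmult_0_r, sin_0, cos_0.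
      assert (Hw := speed_pos a 0 Ha1). field. lra.
Qed.

(** With [P] and [M] the two absolute values, [P > M] would bound
    [exp ((P - M) s)] by a constant [K] for all positive [s]; the [s] with
    [(P - M) s = K] already contradicts [exp K > 1 + K]. *)
Lemma exp_growth_le (c d c' d' p m : R) : 0 < c -> 0 < d -> 0 < c' -> 0 < d' ->
  (forall s, c * exp (s / p) + d * exp (- (s / p))
             <= c' * exp (s / m) + d' * exp (- (s / m))) ->
  Rabs (/ p) <= Rabs (/ m).
Proof.
  intros Hc Hd Hc' Hd' H. apply Rnot_lt_le. intros Hlt.
  set (P := Rabs (/ p)) in *. set (M := Rabs (/ m)) in *.
  set (e := Rmin c d).
  assert (He : 0 < e) by now apply Rmin_glb_lt.
  assert (Hl : forall s, 0 <= s ->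
            e * exp (P * s) <= c * exp (s / p) + d * exp (- (s / p))).
  { intros s Hs. assert (H1 := exp_pos (s / p)). assert (H2 := exp_pos (- (s / p))).
    assert (e <= c) by apply Rmin_l. assert (e <= d) by apply Rmin_r.
    unfold P, Rabs. destruct (Rcase_abs (/ p)).
    - replace (- / p * s) with (- (s / p)) by (unfold Rdiv; ring). nra.
    - replace (/ p * s) with (s / p) by (unfold Rdiv; ring). nra. }
  assert (Hu : forall s, 0 <= s ->
            c' * exp (s / m) + d' * exp (- (s / m)) <= (c' + d') * exp (M * s)).
  { intros s Hs.
    assert (HM : Rabs (s / m) <= M * s).
    { unfold Rdiv. rewrite Rabs_mult, (Rabs_pos_eq s Hs). unfold M. lra. }
    assert (Hexp : forall x, Rabs x <= M * s -> exp x <= exp (M * s)).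
    { intros x Hx. assert (x <= M * s) by (eapply Rle_trans; [apply Rle_abs | exact Hx]).
      destruct (Rle_lt_or_eq_dec _ _ H0) as [L | ->]; [left; now apply exp_increasing | lra]. }
    assert (H1 := Hexp _ HM). rewrite <- Rabs_Ropp in HM. assert (H2 := Hexp _ HM).
    nra. }
  set (K := (c' + d') / e).
  set (s := K / (P - M)).
  assert (HK : 0 < K) by (apply Rdiv_lt_0_compat; lra).
  assert (Hs : 0 < s) by (apply Rdiv_lt_0_compat; lra).
  assert (H1 : e * exp (P * s) <= (c' + d') * exp (M * s)).
  { eapply Rle_trans; [apply Hl; lra|].
    eapply Rle_trans; [apply H | apply Hu; lra]. }
  replace (P * s) with (M * s + K) in H1
    by (unfold s; field; lra).
  rewrite exp_plus in H1.
  assert (H2 := exp_ineq1 K (Rgt_not_eq _ _ HK)).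
  assert (H3 := exp_pos (M * s)).
  assert (H4 : e * exp K <= c' + d').
  { apply (Rmult_le_reg_r (exp (M * s))); trivial. lra. }
  assert (E : e * K = c' + d') by (unfold K; field; lra).
  nra.
Qed.

(** If the catenoid of parameter [a] lies on that of parameter [b], its width at
    each height is at most the width of the latter. *)
Lemma catenoid_set_subset_growth a b : parameter a -> parameter b ->
  (forall p, catenoid_set a p -> catenoid_set b p) -> Rabs (/ a) <= Rabs (/ b).
Proof.
  intros Ha Hb H.
  destruct (frame2_0_growth a Ha) as (c & d & Hc & Hd & E).
  destruct (frame2_0_growth b Hb) as (c' & d' & Hc' & Hd' & E').
  apply (exp_growth_le c d c' d'); trivial.
  intros s. rewrite <- E, <- E'.
  destruct (H (catenoid a 0 s)) as (t & s' & Et); [now exists 0, s|].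
  unfold catenoid in Et. injection Et. intros -> E2 _.
  apply Rmult_eq_reg_l in E2; [|apply Rgt_not_eq, exp_pos].
  rewrite <- E2. now apply frame2_max.
Qed.

Lemma catenoid_family : one_parameter_family catenoid_set catenoid.
Proof.
  split.
  - intros i a t s. apply catenoid_continuous.
  - intros a b Ha Hb Hab H.
    assert (H1 := catenoid_set_subset_growth a b Ha Hb (fun p => proj1 (H p))).
    assert (H2 := catenoid_set_subset_growth b a Hb Ha (fun p => proj2 (H p))).
    assert (E : Rabs (/ a) = Rabs (/ b)) by lra.
    rewrite !Rabs_inv in E. apply Rinv_eq_reg in E.
    destruct (Rcase_abs a) as [La|La].
    + rewrite !Rabs_left in E by nra. lra.
    + rewrite !Rabs_pos_eq in E by (destruct Hb; nra). exact E.
Qed.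

(** * Polar coordinates *)

Definition norm2 (x y : R) : R := x ^ 2 + y ^ 2.
Definition log_modulus (x y : R) : R := ln (norm2 x y) / 2.
Definition argument (x y : R) : R :=
  if Rle_dec 0 y then acos (x / exp (log_modulus x y))
  else - acos (x / exp (log_modulus x y)).

Lemma norm2_pos x y : (x, y) <> RtoC 0 <-> 0 < norm2 x y.
Proof.
  unfold norm2. split.
  - intros H. destruct (Req_dec x 0) as [Hx|Hx]; [destruct (Req_dec y 0) as [Hy|Hy]|].
    + exfalso. apply H. now rewrite Hx, Hy.
    + generalize (pow2_gt_0 y Hy) (pow2_ge_0 x). lra.
    + generalize (pow2_gt_0 x Hx) (pow2_ge_0 y). lra.
  - intros H E. injection E. intros -> ->. lra.
Qed.

Lemma exp_log_modulus x y : 0 < norm2 x y -> exp (log_modulus x y) ^ 2 = norm2 x y.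
Proof.
  intros H. replace (exp (log_modulus x y) ^ 2)
    with (exp (log_modulus x y + log_modulus x y)) by (rewrite exp_plus; ring).
  replace (log_modulus x y + log_modulus x y) with (ln (norm2 x y))
    by (unfold log_modulus; field).
  now apply exp_ln.
Qed.

Lemma polar_form x y : 0 < norm2 x y ->
  x = exp (log_modulus x y) * cos (argument x y) /\
  y = exp (log_modulus x y) * sin (argument x y).
Proof.
  intros H. assert (E := exp_log_modulus x y H).
  assert (Hp := exp_pos (log_modulus x y)). unfold argument.
  set (m := exp (log_modulus x y)) in *. unfold norm2 in E.
  assert (Hx : -1 <= x / m <= 1).
  { assert (-m <= x <= m) by nra. split.
    - apply (Rmult_le_reg_r m); trivial. unfold Rdiv.
      rewrite Rmult_assoc, Rinv_l by lra. lra.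
    - apply (Rmult_le_reg_r m); trivial. unfold Rdiv.
      rewrite Rmult_assoc, Rinv_l by lra. lra. }
  assert (Hs : m * sqrt (1 - (x / m)²) = Rabs y).
  { rewrite <- sqrt_Rsqr_abs. rewrite <- (sqrt_pow2 m) at 1 by lra.
    rewrite <- sqrt_mult.
    - f_equal. unfold Rsqr. transitivity (m ^ 2 - x ^ 2); [field; lra | rewrite E; ring].
    - apply pow2_ge_0.
    - unfold Rsqr. nra. }
  destruct (Rle_dec 0 y) as [Hy|Hy].
  - rewrite cos_acos, sin_acos, Hs by trivial. rewrite Rabs_pos_eq by trivial.
    split; [field; lra | trivial].
  - rewrite cos_neg, sin_neg, cos_acos, sin_acos by trivial.
    rewrite Ropp_mult_distr_r_reverse, Hs, Rabs_left by lra.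
    split; [field; lra | ring].
Qed.

Lemma angle_unique u v :
  cos u = cos v -> sin u = sin v -> exists k : Z, v = u + 2 * PI * IZR k.
Proof.
  intros Ec Es.
  assert (H : sin ((v - u) / 2) = 0).
  { assert (E : cos (v - u) = 1).
    { rewrite cos_minus, Ec, Es. generalize (sin2_cos2' v). lra. }
    replace (v - u) with (2 * ((v - u) / 2)) in E by field.
    rewrite cos_2a_sin in E. nra. }
  destruct (sin_eq_0_0 _ H) as [k Hk]. exists k. lra.
Qed.

(** Near a base point, the argument is given up to full turns by a smooth
    function. *)
Lemma argument_local x0 y0 x y : 0 < norm2 x0 y0 -> 0 < x0 * x + y0 * y ->
  exists k : Z, argument x y =
    argument x0 y0 + atan ((x0 * y + - y0 * x) / (x0 * x + y0 * y)) + 2 * PI * IZR k.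
Proof.
  intros H0 HD.
  assert (H : 0 < norm2 x y).
  { apply norm2_pos. intros E. injection E. intros -> ->. lra. }
  destruct (polar_form x0 y0 H0) as [X0 Y0]. destruct (polar_form x y H) as [X Y].
  assert (M0 := exp_log_modulus x0 y0 H0). assert (M := exp_log_modulus x y H).
  assert (P0 := exp_pos (log_modulus x0 y0)). assert (P := exp_pos (log_modulus x y)).
  unfold norm2 in M0, M.
  set (m0 := exp (log_modulus x0 y0)) in *. set (m := exp (log_modulus x y)) in *.
  set (f0 := argument x0 y0) in *. set (f := argument x y) in *.
  set (D := x0 * x + y0 * y) in *. set (N := x0 * y + - y0 * x).
  assert (Hr : sqrt (1 + (N / D)²) = m0 * m / D).
  { apply Rsqr_inj.
    - apply sqrt_pos.
    - apply Rlt_le, Rdiv_lt_0_compat; trivial. now apply Rmult_lt_0_compat.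
    - rewrite Rsqr_sqrt by (generalize (Rle_0_sqr (N / D)); lra).
      unfold Rsqr. transitivity ((D ^ 2 + N ^ 2) / D ^ 2); [field; lra|].
      replace (D ^ 2 + N ^ 2) with (m0 ^ 2 * m ^ 2)
        by (rewrite M0, M; unfold D, N; ring).
      field. lra. }
  apply angle_unique.
  - rewrite cos_plus, cos_atan, sin_atan, Hr.
    apply (Rmult_eq_reg_l m); [|lra]. rewrite <- X.
    transitivity ((m0 * cos f0 * D - m0 * sin f0 * N) / m0 ^ 2); [field; lra|].
    rewrite <- X0, <- Y0. replace (x0 * D - y0 * N) with (x * m0 ^ 2)
      by (rewrite M0; unfold D, N; ring).
    field. lra.
  - rewrite sin_plus, cos_atan, sin_atan, Hr.
    apply (Rmult_eq_reg_l m); [|lra]. rewrite <- Y.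
    transitivity ((m0 * sin f0 * D + m0 * cos f0 * N) / m0 ^ 2); [field; lra|].
    rewrite <- X0, <- Y0. replace (y0 * D + x0 * N) with (y * m0 ^ 2)
      by (rewrite M0; unfold D, N; ring).
    field. lra.
Qed.

Lemma locally_2d_pos (f : R -> R -> R) x y :
  continuity_2d_pt f x y -> 0 < f x y -> locally_2d (fun u v => 0 < f u v) x y.
Proof.
  intros Hf Hp.
  apply (locally_2d_impl (fun u v => Rabs (f u v - f x y) < mkposreal _ Hp)).
  - apply locally_2d_forall. intros u v. simpl. intros Huv.
    apply Rabs_def2 in Huv. lra.
  - apply Hf.
Qed.

Lemma differentiable_norm2 x y :
  differentiable_pt_lim norm2 x y (2 * x) (2 * y).
Proof.
  assert (D1 := differentiable_pt_lim_comp1 (fun t => t ^ 2) (fun u _ => u) x y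
    (2 * x) 1 0 ltac:(auto_derive; trivial; ring) (differentiable_pt_lim_fst x y)).
  assert (D2 := differentiable_pt_lim_comp1 (fun t => t ^ 2) (fun _ v => v) x y
    (2 * y) 0 1 ltac:(auto_derive; trivial; ring) (differentiable_pt_lim_snd x y)).
  assert (D := differentiable_pt_lim_plus _ _ _ _ _ _ _ _ D1 D2).
  replace (2 * x) with (2 * x * 1 + 2 * y * 0) by ring.
  replace (2 * y) with (2 * x * 0 + 2 * y * 1) at 2 by ring. exact D.
Qed.

Lemma norm2_pos_locally x y :
  0 < norm2 x y -> locally_2d (fun u v => 0 < norm2 u v) x y.
Proof.
  apply locally_2d_pos, differentiable_continuity_pt.
  eexists; eexists; apply differentiable_norm2.
Qed.

(** The argument jumps along a half-line, but a function that is periodic in it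
    does not notice: near [(x, y)] the argument may be replaced by a smooth one.
    The derivatives are those of the composition with the complex logarithm. *)
Lemma differentiable_polar (F : R -> R -> R) (x y Fl Fp : R) :
  (forall l p, F l (p + 2 * PI) = F l p) -> 0 < norm2 x y ->
  differentiable_pt_lim F (log_modulus x y) (argument x y) Fl Fp ->
  differentiable_pt_lim (fun u v => F (log_modulus u v) (argument u v)) x y
    (x / norm2 x y * Fl - y / norm2 x y * Fp) (y / norm2 x y * Fl + x / norm2 x y * Fp).
Proof.
  intros HF H D.
  set (den := fun u v => x * u + y * v + 0).
  set (num := fun u v => - y * u + x * v + 0).
  set (angle := fun u v => argument x y + atan (num u v * / den u v)).
  assert (Hd : 0 < den x y) by (unfold den; unfold norm2 in H; lra).
  assert (Dd : differentiable_pt_lim den x y x y) by apply differentiable_pt_lim_linear.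
  assert (Dn : differentiable_pt_lim num x y (- y) x)
    by apply differentiable_pt_lim_linear.
  assert (E0 : num x y = 0) by (unfold num; ring).
  assert (Ea : angle x y = argument x y).
  { unfold angle. rewrite E0, Rmult_0_l, atan_0. ring. }
  apply (differentiable_pt_lim_ext (fun u v => F (log_modulus u v) (angle u v))).
  - apply (locally_2d_impl (fun u v => 0 < den u v)).
    + apply locally_2d_forall. intros u v Huv. unfold den in Huv.
      destruct (argument_local x y u v H) as [k ->]; [lra|].
      rewrite (periodic_Z _ _ _ (HF _)). unfold angle, num, den, Rdiv.
      now rewrite !Rplus_0_r, (Rplus_comm (- y * u)).
    + apply locally_2d_pos; trivial. apply differentiable_continuity_pt.
      now exists x, y.
  - assert (Dlog : differentiable_pt_lim log_modulus x y (x / norm2 x y) (y / norm2 x y)).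
    { assert (D1 : is_derive (fun n => ln n / 2) (norm2 x y) (/ (2 * norm2 x y))).
      { auto_derive; trivial. field. lra. }
      assert (D2 := differentiable_pt_lim_comp1 _ _ _ _ _ _ _ D1 (differentiable_norm2 x y)).
      replace (x / norm2 x y) with (/ (2 * norm2 x y) * (2 * x)) by (field; lra).
      replace (y / norm2 x y) with (/ (2 * norm2 x y) * (2 * y)) by (field; lra).
      exact D2. }
    assert (Dangle : differentiable_pt_lim angle x y (- y / norm2 x y) (x / norm2 x y)).
    { assert (D1 : is_derive Rinv (den x y) (- / den x y ^ 2)).
      { auto_derive; [lra|]. field. lra. }
      assert (D2 := differentiable_pt_lim_comp1 _ _ _ _ _ _ _ D1 Dd).
      assert (D3 := differentiable_pt_lim_mult _ _ _ _ _ _ _ _ Dn D2).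
      assert (D4 : is_derive (fun m => argument x y + atan m) (num x y * / den x y) 1).
      { rewrite E0, Rmult_0_l. auto_derive; trivial. field. }
      assert (D5 := differentiable_pt_lim_comp1 _ _ _ _ _ _ _ D4 D3).
      rewrite E0 in D5.
      replace (den x y) with (norm2 x y) in D5 by (unfold den, norm2; ring).
      replace (- y / norm2 x y) with
        (1 * (- y * / norm2 x y + 0 * (- / norm2 x y ^ 2 * x))) by (field; lra).
      replace (x / norm2 x y) with
        (1 * (x * / norm2 x y + 0 * (- / norm2 x y ^ 2 * y))) by (field; lra).
      exact D5. }
    rewrite <- Ea in D.
    assert (DF := differentiable_pt_lim_comp F log_modulus angle x y _ _ _ _ _ _
                    D Dlog Dangle).
    replace (x / norm2 x y * Fl - y / norm2 x y * Fp)
      with (Fl * (x / norm2 x y) + Fp * (- y / norm2 x y)) by (field; lra).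
    replace (y / norm2 x y * Fl + x / norm2 x y * Fp)
      with (Fl * (y / norm2 x y) + Fp * (x / norm2 x y)) by ring.
    exact DF.
Qed.

(** * The conformal angle *)

Lemma derive_zero_constant (f : R -> R) :
  (forall x, is_derive f x 0) -> forall x y, f x = f y.
Proof.
  intros D.
  assert (H : forall x y, x < y -> f x = f y).
  { intros x y Hxy.
    destruct (MVT_cor2 f (fun _ => 0) x y Hxy) as (c & E & _).
    - intros c _. apply is_derive_Reals, D.
    - lra. }
  intros x y. destruct (Rtotal_order x y) as [L | [-> | L]]; trivial; auto.
  symmetry. auto.
Qed.

(** A function with derivative at least 1 is onto by the intermediate value
    theorem, and its inverse is 1-Lipschitz. *)
Lemma inverse_of_expanding (V v : R -> R) :
  (forall x, is_derive V x (v x)) -> (forall x, 1 <= v x) ->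
  exists G, (forall y, V (G y) = y) /\ (forall x, G (V x) = x) /\
    forall y, is_derive G y (/ v (G y)).
Proof.
  intros D Hv.
  assert (D' : forall x, derivable_pt_lim V x (v x))
    by (intros x; apply is_derive_Reals, D).
  assert (Cont : continuity V).
  { intros x. apply derivable_continuous_pt. exists (v x). apply D'. }
  assert (Hexp : forall x y, x < y -> y - x <= V y - V x).
  { intros x y Hxy.
    destruct (MVT_cor2 V v x y Hxy (fun c _ => D' c)) as (c & E & _).
    rewrite E. specialize (Hv c). nra. }
  assert (Hsurj : forall y, {x | V x = y}).
  { intros y. set (b := Rabs (y - V 0) + 1).
    assert (Hb : 0 < b) by (unfold b; generalize (Rabs_pos (y - V 0)); lra).
    assert (H1 := Hexp 0 b Hb). assert (H2 := Hexp (- b) 0 ltac:(lra)).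
    assert (H3 := Rle_abs (y - V 0)). assert (H4 := Rle_abs (- (y - V 0))).
    rewrite Rabs_Ropp in H4.
    destruct (IVT_gen V (- b) b y Cont) as (x & _ & Hx).
    - unfold b in *. rewrite Rmin_left, Rmax_right by lra. lra.
    - now exists x. }
  set (G := fun y => proj1_sig (Hsurj y)).
  assert (VG : forall y, V (G y) = y) by (intros y; apply (proj2_sig (Hsurj y))).
  assert (GV : forall x, G (V x) = x).
  { intros x. specialize (VG (V x)).
    destruct (Rtotal_order (G (V x)) x) as [H | [H | H]]; trivial.
    - specialize (Hexp _ _ H). lra.
    - specialize (Hexp _ _ H). lra. }
  assert (Glip : forall x y, x <= y -> 0 <= G y - G x <= y - x).
  { intros x y Hxy. rewrite <- (VG x), <- (VG y) in Hxy.
    rewrite <- (VG x) at 3. rewrite <- (VG y) at 3.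
    destruct (Rtotal_order (G x) (G y)) as [H | [H | H]].
    - specialize (Hexp _ _ H). lra.
    - rewrite H in *. lra.
    - specialize (Hexp _ _ H). lra. }
  exists G. split; [trivial | split; [trivial|]].
  intros y. apply is_derive_Reals.
  assert (Prf : forall c, G (y - 1) <= c <= G (y + 1) -> derivable_pt V c).
  { intros c _. exists (v c). apply D'. }
  assert (Hin : G (y - 1) <= G y <= G (y + 1)).
  { generalize (Glip (y - 1) y ltac:(lra)) (Glip y (y + 1) ltac:(lra)). lra. }
  assert (Ev : derive_pt V (G y) (Prf (G y) Hin) = v (G y))
    by apply derive_pt_eq_0, D'.
  replace (/ v (G y)) with (1 / derive_pt V (G y) (Prf (G y) Hin))
    by (rewrite Ev; unfold Rdiv; ring).
  apply Ranalysis5.derivable_pt_lim_recip_interv; try lra.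
  - apply continuity_pt_locally. intros eps. exists eps. intros z Hz.
    change (Rabs (z - y) < eps) in Hz.
    eapply Rle_lt_trans; [|exact Hz].
    destruct (Rle_dec z y) as [H|H].
    + rewrite (Rabs_minus_sym (G z)), (Rabs_minus_sym z).
      generalize (Glip z y H). intros H1. rewrite !Rabs_pos_eq by lra. lra.
    + generalize (Glip y z ltac:(lra)). intros H1. rewrite !Rabs_pos_eq by lra. lra.
  - intros x _. apply VG.
  - rewrite Ev. specialize (Hv (G y)). lra.
Qed.

(** The conformal coordinate [v] is [V t], the elliptic integral of [/ speed]
    from 0 to [t].  It increases by [V (2 PI)] at each turn, and [tau] rescales
    this increment to [2 PI]; then [P] expresses [t] through the rescaled
    coordinate. *)
Lemma conformal_angle (a : R) : -1 < a < 1 -> exists (tau : R) (P : R -> R),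
  0 < tau /\
  (forall p, is_derive P p (tau * speed a (P p))) /\
  (forall (k : Z) p, P (p + 2 * PI * IZR k) = P p + 2 * PI * IZR k) /\
  (forall p p', P p = P p' -> p = p') /\
  (forall t, exists p, P p = t).
Proof.
  intros Ha. assert (HP := PI_RGT_0).
  set (v := fun t => / speed a t). set (V := fun t => RInt v 0 t : R).
  assert (Hv1 : forall t, 1 <= v t).
  { intros t. unfold v. rewrite <- Rinv_1. apply Rinv_le_contravar.
    - now apply speed_pos.
    - now apply speed_le_1. }
  assert (Cv : forall t, continuous v t).
  { intros t. apply (ex_derive_continuous v). eexists.
    apply (is_derive_inv _ _ _ (is_derive_speed a t Ha)).
    apply Rgt_not_eq. now apply speed_pos. }
  assert (DV : forall t, is_derive V t (v t)).
  { intros t. apply (is_derive_RInt v V 0 t); trivial.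
    exists (mkposreal 1 Rlt_0_1). intros x _. apply (RInt_correct (V := R_CompleteNormedModule)).
    apply (ex_RInt_continuous (V := R_CompleteNormedModule)).
    intros z _. apply Cv. }
  assert (V0 : V 0 = 0) by exact (RInt_point (V := R_CompleteNormedModule) 0 v).
  assert (Vper : forall t, V (t + 2 * PI) = V t + V (2 * PI)).
  { intros t.
    assert (E : V (t + 2 * PI) - V t = V (0 + 2 * PI) - V 0).
    { apply (derive_zero_constant (fun t => V (t + 2 * PI) - V t)). intros x.
      assert (D1 := DV (x + 2 * PI)). assert (D2 := DV x).
      auto_derive; [split; [eexists; apply D1 | split; [eexists; apply D2 | trivial]]|].
      rewrite_derive D2.
      replace (Derive (fun x : R => V x) (x + 2 * PI)) with (v (x + 2 * PI))
        by (symmetry; exact (is_derive_unique _ _ _ D1)).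
      unfold v. rewrite speed_periodic. ring. }
    rewrite V0, Rplus_0_l in E. lra. }
  assert (V2 : 0 < V (2 * PI)).
  { destruct (MVT_cor2 V v 0 (2 * PI)) as (c & E & _); [lra | |].
    - intros c _. apply is_derive_Reals, DV.
    - specialize (Hv1 c). rewrite V0 in E. nra. }
  destruct (inverse_of_expanding V v DV Hv1) as (G & VG & GV & DG).
  set (tau := V (2 * PI) / (2 * PI)).
  assert (Ht : 0 < tau) by (apply Rdiv_lt_0_compat; lra).
  exists tau, (fun p => G (tau * p)). split; [trivial | split; [|split; [|split]]].
  - intros p. assert (D := DG (tau * p)).
    auto_derive; [eexists; apply D|].
    replace (Derive (fun x : R => G x) (tau * p)) with (/ v (G (tau * p)))
      by (symmetry; exact (is_derive_unique _ _ _ D)).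
    unfold v. field. apply Rgt_not_eq. now apply speed_pos.
  - intros k p.
    assert (E := periodic_Z _ (fun p => G (tau * p) - p) (2 * PI)).
    assert (E' : G (tau * (p + 2 * PI * IZR k)) - (p + 2 * PI * IZR k) = G (tau * p) - p).
    { apply E. intros x.
      replace (tau * (x + 2 * PI)) with (V (G (tau * x) + 2 * PI)).
      - rewrite GV. ring.
      - rewrite Vper, VG. unfold tau. field. lra. }
    lra.
  - intros p p' E. apply (f_equal V) in E. rewrite !VG in E.
    apply Rmult_eq_reg_l in E; lra.
  - intros t. exists (V t / tau).
    replace (tau * (V t / tau)) with (V t) by (field; lra). apply GV.
Qed.

(** * The conformal parametrization *)

Section Conformal.

Variables (a tau : R) (P : R -> R).
Hypothesis Ha : parameter a.
Hypothesis Htau : 0 < tau.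
Hypothesis DP : forall p, is_derive P p (tau * speed a (P p)).
Hypothesis P_turn : forall (k : Z) p, P (p + 2 * PI * IZR k) = P p + 2 * PI * IZR k.
Hypothesis P_inj : forall p p', P p = P p' -> p = p'.
Hypothesis P_surj : forall t, exists p, P p = t.

Let Ha1 : -1 < a < 1 := proj1 Ha.
Let Ha0 : a <> 0 := proj2 Ha.

(** The conformal coordinate is [u + i v = tau * log z]. *)
Definition theta (x y : R) : R := P (argument x y).
Definition height (x y : R) : R :=
  a * tau * log_modulus x y + shift a (P (argument x y)).
Definition conformal_map (z : C) : point :=
  catenoid a (theta (fst z) (snd z)) (height (fst z) (snd z)).

Lemma shift_turn (k : Z) t : shift a (t + 2 * PI * IZR k) = shift a t.
Proof.
  apply (periodic_Z _ (shift a)). intros x.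
  replace (x + 2 * PI) with (x + PI + PI) by ring.
  destruct (angular_half_turn a (x + PI)) as (_ & _ & -> & _).
  now destruct (angular_half_turn a x) as (_ & _ & -> & _).
Qed.

Lemma poly_catenoid_periodic f : poly (catenoid_gen a) f ->
  forall t s, f (t + 2 * PI) s = f t s.
Proof.
  induction 1 as [f Hf | c | f g _ IHf _ IHg | f g _ IHf _ IHg]; intros t s; trivial.
  - assert (Hq : twist a (t + 2 * PI) = twist a t /\
                 phase a (t + 2 * PI) s = phase a t s).
    { replace (t + 2 * PI) with (t + PI + PI) by ring.
      destruct (angular_half_turn a (t + PI)) as (_ & -> & _ & ->).
      now destruct (angular_half_turn a t) as (_ & -> & _ & ->). }
    assert (Hw := speed_periodic a t). destruct Hq as [Hq Hr].
    destruct Hf; rewrite ?Hw, ?Hq, ?Hr; trivial.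
    + apply sin_cos_turn.
    + apply sin_cos_turn.
  - now rewrite IHf, IHg.
  - now rewrite IHf, IHg.
Qed.

(** The chain rule through [dt/dv = speed] and [ds = a du + twist dv]. *)
Lemma differentiable_pullback f ft fs x y : poly (catenoid_gen a) f ->
  0 < norm2 x y ->
  differentiable_pt_lim f (theta x y) (height x y) ft fs ->
  differentiable_pt_lim (fun u v => f (theta u v) (height u v)) x y
    (x / norm2 x y * (a * tau * fs)
     - y / norm2 x y * (tau * (speed a (theta x y) * ft + twist a (theta x y) * fs)))
    (y / norm2 x y * (a * tau * fs)
     + x / norm2 x y * (tau * (speed a (theta x y) * ft + twist a (theta x y) * fs))).
Proof.
  intros Hf Hn D.
  apply (differentiable_polar (fun l p => f (P p) (a * tau * l + shift a (P p)))); trivial.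
  - intros l p. replace (p + 2 * PI) with (p + 2 * PI * IZR 1) by ring.
    rewrite P_turn, shift_turn. replace (2 * PI * IZR 1) with (2 * PI) by ring.
    now apply poly_catenoid_periodic.
  - set (l0 := log_modulus x y) in *. set (p0 := argument x y).
    assert (D1 : differentiable_pt_lim (fun _ p => P p) l0 p0 (tau * speed a (P p0) * 0)
                   (tau * speed a (P p0) * 1)).
    { apply (differentiable_pt_lim_comp1 P (fun _ p => p)); trivial.
      apply differentiable_pt_lim_snd. }
    assert (D2 := differentiable_pt_lim_comp1 (shift a) _ _ _ _ _ _
                    (is_derive_shift a (P p0) Ha1) D1).
    assert (D3 := differentiable_pt_lim_plus _ _ _ _ _ _ _ _
                    (differentiable_pt_lim_linear (a * tau) 0 0 l0 p0) D2).
    assert (D4 : differentiable_pt_lim (fun l p => a * tau * l + shift a (P p)) l0 p0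
      (a * tau + twist a (P p0) / speed a (P p0) * (tau * speed a (P p0) * 0))
      (0 + twist a (P p0) / speed a (P p0) * (tau * speed a (P p0) * 1))).
    { eapply differentiable_pt_lim_ext; [|exact D3].
      apply locally_2d_forall. intros u v. ring. }
    assert (D5 := differentiable_pt_lim_comp f _ _ l0 p0 _ _ _ _ _ _ D D1 D4).
    assert (Hw := speed_pos a (P p0) Ha1).
    replace (a * tau * fs) with (ft * (tau * speed a (P p0) * 0) + fs *
      (a * tau + twist a (P p0) / speed a (P p0) * (tau * speed a (P p0) * 0)))
      by ring.
    replace (tau * (speed a (theta x y) * ft + twist a (theta x y) * fs)) with (ft * (tau * speed a (P p0) * 1) + fs *
      (0 + twist a (P p0) / speed a (P p0) * (tau * speed a (P p0) * 1)))
      by (unfold theta; fold p0; field; lra).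
    exact D5.
Qed.

(** The functions [x / (x^2 + y^2)] and [y / (x^2 + y^2)] are the derivatives of the
    logarithm of the modulus and, up to sign, of the argument. *)
Inductive pullback_gen : (R -> R -> R) -> Prop :=
| pull_x : pullback_gen (fun x y => x / norm2 x y)
| pull_y : pullback_gen (fun x y => y / norm2 x y)
| pull_poly f : poly (catenoid_gen a) f ->
    pullback_gen (fun x y => f (theta x y) (height x y)).

Lemma pullback_closed :
  derivation_closed (fun x y => (x, y) <> RtoC 0) (poly pullback_gen).
Proof.
  apply poly_derivation_closed.
  assert (Kx : poly pullback_gen (fun x y => x / norm2 x y))
    by (apply poly_gen; constructor).
  assert (Ky : poly pullback_gen (fun x y => y / norm2 x y))
    by (apply poly_gen; constructor).
  assert (K1 : poly pullback_gen (fun x y =>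
            y / norm2 x y * (y / norm2 x y) - x / norm2 x y * (x / norm2 x y))).
  { apply (poly_minus _ (fun x y => y / norm2 x y * (y / norm2 x y))
             (fun x y => x / norm2 x y * (x / norm2 x y)));
    apply (poly_mult _ (fun x y => _ / norm2 x y) (fun x y => _ / norm2 x y)); trivial. }
  assert (K2 : poly pullback_gen (fun x y =>
            - 2 * (x / norm2 x y * (y / norm2 x y)))).
  { apply (poly_mult _ (fun _ _ => - 2) (fun x y => x / norm2 x y * (y / norm2 x y)));
      [apply poly_const|].
    apply (poly_mult _ (fun x y => x / norm2 x y) (fun x y => y / norm2 x y)); trivial. }
  assert (Dinv : forall x y, 0 < norm2 x y ->
    differentiable_pt_lim (fun x y => / norm2 x y) x y
      (- / norm2 x y ^ 2 * (2 * x)) (- / norm2 x y ^ 2 * (2 * y))).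
  { intros x y H. apply (differentiable_pt_lim_comp1 Rinv norm2).
    - auto_derive; [lra|]. field. lra.
    - apply differentiable_norm2. }
  intros f [ | | g Kg].
  - eexists; eexists; split; [exact K1 | split; [exact K2|]].
    intros x y Hxy. apply norm2_pos in Hxy.
    assert (D := differentiable_pt_lim_mult _ _ _ _ _ _ _ _
                   (differentiable_pt_lim_fst x y) (Dinv x y Hxy)).
    replace (_ - _) with (1 * / norm2 x y + x * (- / norm2 x y ^ 2 * (2 * x)))
      by (unfold norm2 in *; field; lra).
    replace (- 2 * _) with (0 * / norm2 x y + x * (- / norm2 x y ^ 2 * (2 * y)))
      by (field; lra).
    exact D.
  - eexists; eexists; split; [exact K2 | split; [exact (poly_opp _ _ K1)|]].
    intros x y Hxy. cbv beta. apply norm2_pos in Hxy.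
    assert (D := differentiable_pt_lim_mult _ _ _ _ _ _ _ _
                   (differentiable_pt_lim_snd x y) (Dinv x y Hxy)).
    replace (- (_ - _)) with (1 * / norm2 x y + y * (- / norm2 x y ^ 2 * (2 * y)))
      by (unfold norm2 in *; field; lra).
    replace (- 2 * _) with (0 * / norm2 x y + y * (- / norm2 x y ^ 2 * (2 * x)))
      by (field; lra).
    exact D.
  - destruct (catenoid_gen_closed a Ha g Kg) as (gt & gs & Kt & Ks & D).
    set (s' := fun x y => gs (theta x y) (height x y)).
    set (p' := fun x y => speed a (theta x y) * gt (theta x y) (height x y)
                         + twist a (theta x y) * gs (theta x y) (height x y)).
    assert (Ks' : poly pullback_gen s').
    { apply poly_gen. now constructor. }
    assert (Kp' : poly pullback_gen p').
    { apply poly_gen. apply (pull_poly (fun t s => speed a t * gt t s + twist a t * gs t s)).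
      apply (poly_plus _ (fun t s => speed a t * gt t s) (fun t s => twist a t * gs t s)).
      - apply (poly_mult _ (fun t _ => speed a t)); trivial. apply poly_gen. constructor.
      - apply (poly_mult _ (fun t _ => twist a t)); trivial. apply poly_gen. constructor. }
    assert (K : forall c h k, poly pullback_gen h -> poly pullback_gen k ->
              poly pullback_gen (fun x y => h x y * (c * k x y))).
    { intros c h k Hh Hk. apply (poly_mult _ h (fun x y => c * k x y)); trivial.
      apply (poly_mult _ (fun _ _ => c) k); trivial. apply poly_const. }
    exists (fun x y => x / norm2 x y * (a * tau * s' x y) - y / norm2 x y * (tau * p' x y)),
           (fun x y => y / norm2 x y * (a * tau * s' x y) + x / norm2 x y * (tau * p' x y)).
    split; [|split].
    + apply (poly_minus _ (fun x y => x / norm2 x y * (a * tau * s' x y))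
               (fun x y => y / norm2 x y * (tau * p' x y))).
      * now apply (K (a * tau) (fun x y => x / norm2 x y) s').
      * now apply (K tau (fun x y => y / norm2 x y) p').
    + apply (poly_plus _ (fun x y => y / norm2 x y * (a * tau * s' x y))
               (fun x y => x / norm2 x y * (tau * p' x y))).
      * now apply (K (a * tau) (fun x y => y / norm2 x y) s').
      * now apply (K tau (fun x y => x / norm2 x y) p').
    + intros x y Hxy. apply norm2_pos in Hxy.
      apply (differentiable_pullback g _ _ x y Kg Hxy). now apply D.
Qed.

Let Y (x y : R) : point := conformal_map (x, y).

Lemma conformal_map_smooth i :
  smooth_on (fun x y => (x, y) <> RtoC 0) (comp Y i).
Proof.
  apply (derivation_closed_smooth _ (poly pullback_gen)).
  - intros x y H. apply norm2_pos in H.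
    apply (locally_2d_impl (fun u v => 0 < norm2 u v)).
    + apply locally_2d_forall. intros u v. apply norm2_pos.
    + now apply norm2_pos_locally.
  - apply pullback_closed.
  - apply poly_gen. apply (pull_poly (comp (catenoid a) i)). apply poly_catenoid.
Qed.

Definition combination (l : R) (v : point) (m : R) (w : point) : point :=
  (l * coord A1 v + m * coord A1 w, l * coord A2 v + m * coord A2 w,
   l * coord A3 v + m * coord A3 w).

Lemma inner_combination p l v m w l' m' :
  inner p (combination l v m w) (combination l' v m' w) =
  l * l' * inner p v v + (l * m' + m * l') * inner p v w + m * m' * inner p w w.
Proof. rewrite !inner_sol. simpl. ring. Qed.

(** With [xi] and [eta] for the derivatives of [u], both tangent vectors are
    combinations of the vectors [a Xs] and [speed Xt + twist Xs] that correspond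
    to [u] and [v]. *)
Lemma lift_conformal_map x y : 0 < norm2 x y ->
  let t := theta x y in let s := height x y in
  let Xt := lift du (catenoid a) t s in let Xs := lift dv (catenoid a) t s in
  let xi := x / norm2 x y * tau in let eta := y / norm2 x y * tau in
  lift du Y x y =
    combination (- eta * speed a t) Xt (xi * a - eta * twist a t) Xs /\
  lift dv Y x y =
    combination (xi * speed a t) Xt (eta * a + xi * twist a t) Xs.
Proof.
  intros Hn t s Xt Xs xi eta.
  assert (H : forall i,
    du (comp Y i) x y = - eta * speed a t * du (comp (catenoid a) i) t s
      + (xi * a - eta * twist a t) * dv (comp (catenoid a) i) t s /\
    dv (comp Y i) x y = xi * speed a t * du (comp (catenoid a) i) t s
      + (eta * a + xi * twist a t) * dv (comp (catenoid a) i) t s).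
  { intros i.
    destruct (catenoid_gen_closed a Ha _ (poly_catenoid a i)) as (ft & fs & _ & _ & D).
    specialize (D t s I). destruct (differentiable_pt_lim_unique _ _ _ _ _ D) as [Et Es].
    change (du (comp (catenoid a) i) t s = ft t s) in Et.
    change (dv (comp (catenoid a) i) t s = fs t s) in Es. rewrite Et, Es.
    destruct (differentiable_pt_lim_unique _ _ _ _ _
      (differentiable_pullback _ _ _ x y (poly_catenoid a i) Hn D)) as [Ex Ey].
    unfold du, dv.
    change (comp Y i) with (fun u v => comp (catenoid a) i (theta u v) (height u v)).
    cbv beta. rewrite Ex, Ey. fold t. unfold xi, eta. split; ring. }
  unfold lift, combination. split.
  - now rewrite !(fun i => proj1 (H i)).
  - now rewrite !(fun i => proj2 (H i)).
Qed.

(** The vectors that correspond to [u] and [v] are orthogonal by [HF], and have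
    the same length by [HE]. *)
Lemma conformal_map_conformal x y : (x, y) <> RtoC 0 ->
  fE Y x y > 0 /\ fE Y x y = fG Y x y /\ fF Y x y = 0.
Proof.
  intros Hn. apply norm2_pos in Hn.
  destruct (lift_conformal_map x y Hn) as [Hx Hy].
  unfold fE, fF, fG. rewrite Hx, Hy. clear Hx Hy. rewrite !inner_combination.
  change (Y x y) with (catenoid a (theta x y) (height x y)).
  set (t := theta x y). set (s := height x y).
  fold (fE (catenoid a) t s) (fF (catenoid a) t s) (fG (catenoid a) t s).
  assert (Hw := speed_pos a t Ha1).
  assert (HF : speed a t * fF (catenoid a) t s = - twist a t * fG (catenoid a) t s).
  { rewrite fF_catenoid, fG_catenoid, tangential_cosh_sqr by trivial.
    unfold radius, tangential. field. split; trivial; lra. }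
  assert (HE : speed a t ^ 2 * fE (catenoid a) t s
               = (a ^ 2 + twist a t ^ 2) * fG (catenoid a) t s).
  { rewrite fE_catenoid, fG_catenoid, tangential_cosh_sqr, twist_sqr by trivial.
    unfold radius. field. lra. }
  assert (HG : 0 < fG (catenoid a) t s).
  { rewrite fG_catenoid by trivial. generalize (cosh_pos (phase a t s)). nra. }
  revert HF HE HG.
  generalize (fE (catenoid a) t s) (fF (catenoid a) t s) (fG (catenoid a) t s).
  intros E F G HF HE HG.
  set (xi := x / norm2 x y * tau). set (eta := y / norm2 x y * tau).
  set (w := speed a t) in *. set (q := twist a t) in *.
  assert (Hpos : 0 < xi ^ 2 + eta ^ 2).
  { replace (xi ^ 2 + eta ^ 2) with (tau ^ 2 / norm2 x y)
      by (unfold xi, eta; unfold norm2 in *; field; lra).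
    apply Rdiv_lt_0_compat; trivial. nra. }
  replace (_ * _ * E + _ * F + _ * _ * G)
    with (eta ^ 2 * (w ^ 2 * E) - 2 * eta * (xi * a - eta * q) * (w * F)
          + (xi * a - eta * q) ^ 2 * G) by ring.
  replace (xi * w * (xi * w) * E + _ * F + _ * _ * G)
    with (xi ^ 2 * (w ^ 2 * E) + 2 * xi * (eta * a + xi * q) * (w * F)
          + (eta * a + xi * q) ^ 2 * G) by ring.
  replace (- eta * w * (xi * w) * E + _ * F + _ * _ * G)
    with (- eta * xi * (w ^ 2 * E)
          + (xi * (xi * a - eta * q) - eta * (eta * a + xi * q)) * (w * F)
          + (xi * a - eta * q) * (eta * a + xi * q) * G) by ring.
  rewrite HE, HF. split; [|split; ring].
  replace (_ + _) with ((xi ^ 2 + eta ^ 2) * a ^ 2 * G) by ring.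
  apply Rmult_lt_0_compat; trivial. apply Rmult_lt_0_compat; trivial.
  now apply pow2_gt_0.
Qed.

Lemma conformal_map_injective (z z' : C) : z <> RtoC 0 -> z' <> RtoC 0 ->
  conformal_map z = conformal_map z' -> z = z'.
Proof.
  destruct z as [x y], z' as [x' y']. intros Hz Hz' E.
  apply norm2_pos in Hz. apply norm2_pos in Hz'.
  apply (catenoid_injective a Ha) in E. unfold height, theta in E. simpl in E.
  destruct E as [Es [k Ek]]. rewrite Ek, shift_turn in Es. rewrite <- P_turn in Ek.
  apply P_inj in Ek.
  assert (El : log_modulus x y = log_modulus x' y').
  { apply (Rmult_eq_reg_l (a * tau)); [lra|].
    apply Rmult_integral_contrapositive_currified; trivial. lra. }
  assert (Ec : cos (argument x' y') = cos (argument x y)).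
  { rewrite Ek. apply (periodic_Z _ cos). intros; apply sin_cos_turn. }
  assert (Es' : sin (argument x' y') = sin (argument x y)).
  { rewrite Ek. apply (periodic_Z _ sin). intros; apply sin_cos_turn. }
  destruct (polar_form x y Hz) as [X1 X2]. destruct (polar_form x' y' Hz') as [X1' X2'].
  f_equal.
  - etransitivity; [exact X1|]. etransitivity; [|symmetry; exact X1'].
    now rewrite El, Ec.
  - etransitivity; [exact X2|]. etransitivity; [|symmetry; exact X2'].
    now rewrite El, Es'.
Qed.

Lemma conformal_map_surjective p :
  catenoid_set a p <-> exists z : C, z <> RtoC 0 /\ conformal_map z = p.
Proof.
  split.
  - intros (t & s & <-). destruct (P_surj t) as [phi Hphi].
    set (l := (s - shift a t) / (a * tau)).
    set (x := exp l * cos phi). set (y := exp l * sin phi).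
    assert (Hl := exp_pos l).
    assert (En : norm2 x y = exp (l + l)).
    { unfold norm2, x, y. rewrite exp_plus.
      transitivity (exp l * exp l * (sin phi ^ 2 + cos phi ^ 2)); [ring|].
      rewrite sin2_cos2'. ring. }
    assert (Hn : 0 < norm2 x y) by (rewrite En; apply exp_pos).
    assert (El : log_modulus x y = l).
    { unfold log_modulus. rewrite En, ln_exp. field. }
    destruct (polar_form x y Hn) as [Ex Ey]. rewrite El in Ex, Ey.
    apply Rmult_eq_reg_l in Ex; [|lra]. apply Rmult_eq_reg_l in Ey; [|lra].
    destruct (angle_unique _ _ Ex Ey) as [k Hk].
    exists (x, y). split; [now apply norm2_pos|].
    unfold conformal_map, height, theta. simpl. rewrite El, Hk, P_turn, shift_turn, Hphi.
    rewrite (periodic_Z _ (fun t => catenoid a t _) (2 * PI))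
      by (intros; apply catenoid_periodic).
    f_equal. unfold l. field. split; trivial; lra.
  - intros (z & _ & <-). unfold catenoid_set, conformal_map. eauto.
Qed.

End Conformal.

Lemma catenoid_conformal a : parameter a ->
  conformal_to_punctured_plane (catenoid_set a).
Proof.
  intros Ha. destruct (conformal_angle a (proj1 Ha)) as (tau & P & Ht & DP & PT & PI & PS).
  exists (conformal_map a tau P). split; [|split; [|split]].
  - now apply conformal_map_smooth.
  - now apply conformal_map_injective.
  - now apply conformal_map_surjective.
  - now apply conformal_map_conformal.
Qed.

Theorem mainTheorem1 :
  exists (S : R -> point -> Prop) (X : R -> R -> R -> point),
    one_parameter_family S X /\
    forall alpha : R, -1 < alpha < 1 /\ alpha <> 0 ->
      properly_embedded_minimal_annulus (S alpha) (X alpha) /\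
      (forall lambda : R,
         (exists p, S alpha p /\ coord A3 p = lambda) /\
         closed_embedded_convex_curve
           (fun x1 x2 => S alpha (x1, x2, lambda))) /\
      conformal_to_punctured_plane (S alpha) /\
      invariant_under rotation_x3 (S alpha) /\
      invariant_under reflection_x1 (S alpha) /\
      invariant_under reflection_x2 (S alpha).
Proof.
  exists catenoid_set, catenoid. split; [exact catenoid_family|].
  intros a Ha. split; [|split; [|split; [|split; [|split]]]].
  - split; [|split].
    + now apply catenoid_proper_embedding.
    + now apply catenoid_minimal.
    + intros p. reflexivity.
  - intros lambda. split.
    + exists (catenoid a 0 lambda). split; [now exists 0, lambda | reflexivity].
    + now apply catenoid_section_convex.
  - now apply catenoid_conformal.
  - apply catenoid_set_rotation.
  - apply catenoid_set_reflection_x1.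
  - apply catenoid_set_reflection_x2.
Qed.
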